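(* Let $\mathcal{C}_1 \subset V_1$ and $\mathcal{C}_2 \subset V_2$ be proper cones in finite-dimensional real vector spaces $V_1, V_2$. Then the pair $(\mathcal{C}_1,\mathcal{C}_2)$ is nuclear, i.e. $\mathcal{C}_1 \odot_{\min} \mathcal{C}_2 = \mathcal{C}_1 \otimes_{\max} \mathcal{C}_2$, if and only if $\mathcal{C}_1$ or $\mathcal{C}_2$ is classical.
   Context: All vector spaces are real and finite-dimensional. A (convex) cone in $V$ is a subset $\mathcal{C}\subset V$ with $sx+ty\in\mathcal{C}$ for all $x,y\in\mathcal{C}$ and $s,t\in[0,\infty)$. It is proper if it is closed, $\mathcal{C}\cap(-\mathcal{C})=\{0\}$ and $\mathcal{C}-\mathcal{C}=V$. The dual cone is $\mathcal{C}^*=\{f\in V^* : f(x)\geq 0 \text{ for every } x\in\mathcal{C}\}$. For cones $\mathcal{C}_1\subset V_1$, $\mathcal{C}_2\subset V_2$, the minimal tensor product is $$\mathcal{C}_1\odot_{\min}\mathcal{C}_2=\operatorname{conv}\{x_1\otimes x_2 : x_1\in\mathcal{C}_1,\ x_2\in\mathcal{C}_2\}\subset V_1\otimes V_2,$$ and the maximal tensor product is $$\mathcal{C}_1\otimes_{\max}\mathcal{C}_2=\{z\in V_1\otimes V_2 : (f_1\otimes f_2)(z)\geq 0 \text{ for every } f_1\in\mathcal{C}_1^*,\ f_2\in\mathcal{C}_2^*\}.$$ A cone $\mathcal{C}\subset V$ is classical if there is a vector space basis $A$ of $V$ such that $\mathcal{C}$ is the cone generated by $A$ (equivalently, $\mathcal{C}$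 is linearly isomorphic to $\mathbb{R}_+^{d}$ with $d=\dim V$). *)

(* Defs.v *)
From HB Require Import structures.
From mathcomp Require Import all_boot all_order all_algebra.
From mathcomp Require Import all_classical all_reals topology normedtype.

Set Implicit Arguments.
Unset Strict Implicit.
Unset Printing Implicit Defensive.

Import Order.TTheory GRing.Theory Num.Theory.
Import numFieldNormedType.Exports.

Local Open Scope classical_set_scope.
Local Open Scope ring_scope.

Notation dual V := 'Hom(V, _^o).

(* V1 ⊗ V2 is realized as the space Hom(V1^*, V2), with
   x1 ⊗ x2 := (f |-> f(x1) x2); [tensor_universal] below checks that this is a
   tensor product of V1 and V2. *)
Notation tensor V1 V2 := 'Hom(dual V1, V2).

Section Cones.
Variables (R : realType) (V : vectType R).
Implicit Types C A : set V.

Definition is_cone C :=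
  forall (x y : V) (s t : R), C x -> C y -> 0 <= s -> 0 <= t ->
    C (s *: x + t *: y).

(* A [vectType] carries no topology: the usual one is transported from R^n by
   the coordinates in a basis, and does not depend on the basis. *)
Definition closed_vect A :=
  closed (passmx.vecof (vbasis {:V}) @^-1` A : set 'rV[R]_(\dim {:V})).

Definition is_proper C :=
  [/\ is_cone C,
      closed_vect C,
      C `&` [set - x | x in C] = [set 0]
    & [set x - y | x in C & y in C] = setT].

Definition dual_cone C : set (dual V) :=
  [set f | forall x, C x -> 0 <= (f x : R)].

Definition conv A : set V :=
  [set z | exists (n : nat) (w : 'I_n -> R) (x : 'I_n -> V),
    [/\ forall i, 0 <= w i,
        \sum_(i < n) w i = 1,
        forall i, A (x i)
      & z = \sum_(i < n) w i *: x i]].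

(* The empty sum is allowed, so that the empty family generates {0}. *)
Definition cone_gen (a : seq V) : set V :=
  [set z | exists c : 'I_(size a) -> R,
    (forall i, 0 <= c i) /\ z = \sum_(i < size a) c i *: a`_i].

Definition is_classical C :=
  exists a : seq V, basis_of {:V} a /\ C = cone_gen a.

End Cones.

Section Tensor.
Variables (R : realType) (V1 V2 : vectType R).

Definition tens (x1 : V1) (x2 : V2) : tensor V1 V2 :=
  linfun (fun f : dual V1 => (f x1 : R) *: x2).

Definition tens_fun (f1 : dual V1) (f2 : dual V2) : dual (tensor V1 V2) :=
  linfun (fun z : tensor V1 V2 => f2 (z f1)).

Lemma linfunE (U W : vectType R) (h : U -> W) : linear h -> linfun h =1 h.
Proof.
move=> lin u.
pose mix := GRing.isLinear.Build R U W _ h lin.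
pose L : {linear U -> W} := HB.pack h mix.
exact: (lfunE L).
Qed.

Lemma tensE x1 x2 f : tens x1 x2 f = (f x1 : R) *: x2.
Proof.
apply: (linfunE (h := fun f : dual V1 => (f x1 : R) *: x2)) => a u v.
by rewrite add_lfunE scale_lfunE scalerDl scalerA.
Qed.

Lemma tens_funE f1 f2 z : tens_fun f1 f2 z = f2 (z f1).
Proof.
apply: (linfunE (h := fun z : tensor V1 V2 => f2 (z f1))) => a u v.
by rewrite add_lfunE scale_lfunE linearP.
Qed.

Lemma tens_fun_tens f1 f2 x1 x2 :
  tens_fun f1 f2 (tens x1 x2) = (f1 x1 : R) * (f2 x2 : R).
Proof. by rewrite tens_funE tensE linearZ. Qed.

Lemma tens_bilinear : bilinear_for *:%R *:%R tens.
Proof.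
split=> [x2 a u v | x1 a u v]; apply/lfunP => f;
  rewrite !(add_lfunE, scale_lfunE, tensE).
  by rewrite linearP scalerDl scalerA.
by rewrite scalerDr !scalerA mulrC.
Qed.

Let n1 := \dim {:V1}.
Let b1 := vbasis {:V1}.
Let co1 (i : 'I_n1) : dual V1 := linfun (coord b1 i : V1 -> R^o).

Lemma tens_decomp (z : tensor V1 V2) : z = \sum_(i < n1) tens b1`_i (z (co1 i)).
Proof.
apply/lfunP => f; rewrite sum_lfunE.
under eq_bigr do rewrite tensE -linearZ.
rewrite -linear_sum; congr (z _); apply/lfunP => x.
rewrite sum_lfunE {1}(coord_vbasis (memvf x)) linear_sum.
by apply: eq_bigr => i _; rewrite scale_lfunE linearZ lfunE; exact: mulrC.
Qed.

Theorem tensor_universal (W : vectType R) (b : {bilinear V1 -> V2 -> W}) :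
  exists! g : 'Hom(tensor V1 V2, W), forall x1 x2, g (tens x1 x2) = b x1 x2.
Proof.
pose h (z : tensor V1 V2) := \sum_(i < n1) b b1`_i (z (co1 i)).
have lin : linear h.
  move=> a u v; rewrite scaler_sumr -big_split; apply: eq_bigr => i _ /=.
  by rewrite add_lfunE scale_lfunE linearPr.
exists (linfun h); split=> [x1 x2 | g gE].
  rewrite linfunE // [in RHS](coord_vbasis (memvf x1)) linear_sumlz.
  by apply: eq_bigr => i _; rewrite tensE lfunE linearZr_LR linearZl_LR.
apply/lfunP => z; rewrite linfunE // [in RHS](tens_decomp z) [RHS]linear_sum.
by apply: eq_bigr => i _ /=; rewrite gE.
Qed.

Definition min_tensor (C1 : set V1) (C2 : set V2) : set (tensor V1 V2) :=
  conv [set tens x1 x2 | x1 in C1 & x2 in C2].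

Definition max_tensor (C1 : set V1) (C2 : set V2) : set (tensor V1 V2) :=
  [set z | forall f1 f2, dual_cone C1 f1 -> dual_cone C2 f2 ->
    0 <= (tens_fun f1 f2 z : R)].

Definition nuclear (C1 : set V1) (C2 : set V2) :=
  min_tensor C1 C2 = max_tensor C1 C2.

End Tensor.

(* Main.v *)
Require Import Defs.
From mathcomp Require Import all_boot all_order all_algebra.
From mathcomp Require Import all_classical all_reals topology normedtype.
From mathcomp Require Import derive ring lra.

(** A non-classical cone C has a face F with vectors x1 + x2 = x3 + x4 in F
    and functionals f1 + f2 = f3 + f4, nonnegative on F, such that fi(xi) =
    0: the xi are the vertices of a kite, each on one side of the square cut
    out by the fi. Moreover x1 <> 0 and F avoids the two vertices f1 = f3 =
    0 and f1 = f4 = 0 of the square. To find them, take linearly independent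
    exposed vectors, minimal with an interior sum; since C is not simplicial
    their span W is a proper subspace. Let f1 expose one of them, let f2
    vanish on the others, and set u = f1 + f2. In the section u = 1 of C,
    projected along W, the chord of extremal ratio through the image of W
    has parallel supporting hyperplanes at its ends; these give f3, f4, x3,
    x4 with x3 + x4 in W. If x3 + x4 has no component on the chosen exposed
    vector, the face f2 = 0 is again non-classical and one argues by
    induction on the dimension.

    Given such data x, f for C1 and y, g for C2, the tensor z = x1 (y3 - y2)
    + x3 y4 + x4 y2 (a Popescu-Rohrlich box of the two kites) is in the
    maximal tensor product. The Clauser-Horne form f4 g4 + f2 g3 + f3 g2 -
    f2 g2 is nonnegative on products, and equals t t' on z with t = f3(x1) -
    f2(x4) and t' = g3(y1) - g2(y4); exchanging the indices 3 and 4 in C2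
    changes the sign of t'. With t t' <= 0, a decomposition of z into
    products must consist of zeros of this form, and because of the missing
    vertices f2 g2 vanishes at all of them, hence at z, which is impossible. *)

Set Implicit Arguments.
Unset Strict Implicit.
Unset Printing Implicit Defensive.

Import Order.TTheory GRing.Theory Num.Theory.
Import numFieldNormedType.Exports passmx.

Local Open Scope classical_set_scope.
Local Open Scope ring_scope.

(** * Euclidean geometry of row vectors *)

Section DotProduct.
Context {R : realType} {n : nat}.
Implicit Types (x y z : 'rV[R]_n).

Definition dot x y : R := \sum_i x 0 i * y 0 i.

Lemma dotC x y : dot x y = dot y x.
Proof. by apply: eq_bigr => i _; rewrite mulrC. Qed.

Lemma dotDr x y z : dot x (y + z) = dot x y + dot x z.
Proof. by rewrite -big_split; apply: eq_bigr => i _; rewrite mxE mulrDr. Qed.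

Lemma dotZr x a y : dot x (a *: y) = a * dot x y.
Proof. by rewrite mulr_sumr; apply: eq_bigr => i _; rewrite mxE mulrCA. Qed.

Lemma dotNr x y : dot x (- y) = - dot x y.
Proof. by rewrite -scaleN1r dotZr mulN1r. Qed.

Lemma dotBr x y z : dot x (y - z) = dot x y - dot x z.
Proof. by rewrite dotDr dotNr. Qed.

Lemma dot0r x : dot x 0 = 0.
Proof. by rewrite -(scale0r 0) dotZr mul0r. Qed.

Lemma dotDl x y z : dot (y + z) x = dot y x + dot z x.
Proof. by rewrite dotC dotDr !(dotC x). Qed.

Lemma dotZl x a y : dot (a *: y) x = a * dot y x.
Proof. by rewrite dotC dotZr dotC. Qed.

Lemma dotNl x y : dot (- y) x = - dot y x.
Proof. by rewrite dotC dotNr dotC. Qed.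

Lemma dotBl x y z : dot (y - z) x = dot y x - dot z x.
Proof. by rewrite dotDl dotNl. Qed.

Lemma dot0l x : dot 0 x = 0.
Proof. by rewrite dotC dot0r. Qed.

Lemma dot_sumr (I : Type) (r : seq I) (P : pred I) (F : I -> 'rV[R]_n) x :
  dot x (\sum_(i <- r | P i) F i) = \sum_(i <- r | P i) dot x (F i).
Proof.
by elim/big_rec2: _ => [|i y1 y2 _ <-]; rewrite ?dot0r ?dotDr.
Qed.

Lemma dot_suml (I : Type) (r : seq I) (P : pred I) (F : I -> 'rV[R]_n) x :
  dot (\sum_(i <- r | P i) F i) x = \sum_(i <- r | P i) dot (F i) x.
Proof. by rewrite dotC dot_sumr; apply: eq_bigr => i _; rewrite dotC. Qed.

Lemma dot_ge0 x : 0 <= dot x x.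
Proof. by apply: sumr_ge0 => i _; rewrite -expr2 sqr_ge0. Qed.

Lemma dot_eq0 x : (dot x x == 0) = (x == 0).
Proof.
apply/idP/eqP => [|->]; last by rewrite dot0r.
rewrite psumr_eq0 => [/allP x0|i _]; last by rewrite -expr2 sqr_ge0.
apply/rowP => i; have := x0 i (mem_index_enum i).
by rewrite /= mulf_eq0 orbb mxE => /eqP.
Qed.

Lemma dot_gt0 x : x != 0 -> 0 < dot x x.
Proof. by rewrite lt_def dot_ge0 dot_eq0 andbT. Qed.

Lemma coord_le_dot x i : x 0 i ^+ 2 <= dot x x.
Proof.
rewrite /dot (bigD1 i)//= -expr2 lerDl.
by apply: sumr_ge0 => j _; rewrite -expr2 sqr_ge0.
Qed.

Lemma mulmx_tr_dot m (B : 'M[R]_(m, n)) x i :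
  (x *m B^T) 0 i = dot x (row i B).
Proof. by rewrite mxE; apply: eq_bigr => j _; rewrite !mxE. Qed.

Lemma continuous_dot (T : topologicalType) (f g : T -> 'rV[R]_n) :
  continuous f -> continuous g -> continuous (fun t => dot (f t) (g t)).
Proof.
move=> cf cg.
apply: (@continuous_big R^o 'I_n +%R 0 xpredT _ T) => [|i _];
  first exact: add_continuous.
move=> t; apply: (@continuousM R T (fun t => f t 0 i) (fun t => g t 0 i)).
- apply: (@continuous_comp _ _ _ f (fun v : 'rV[R]_n => v 0 i)).
    exact: cf.
  exact: coord_continuous.
- apply: (@continuous_comp _ _ _ g (fun v : 'rV[R]_n => v 0 i)).
    exact: cg.
  exact: coord_continuous.
Qed.

Lemma closed_coord_bounded_compact (A : set 'rV[R]_n) (M : R) :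
  closed A -> (forall x, A x -> forall i, `|x 0 i| <= M) -> compact A.
Proof.
move=> clA AM.
have cM : compact [set v : 'rV[R]_n | forall i, v ord0 i \in `[- M, M]].
  apply: (@rV_compact _ _ (fun=> `[- M, M]%classic)) => _.
  exact: segment_compact.
apply: (subclosed_compact clA cM) => x Ax i.
by rewrite in_itv /= -ler_norml; exact: AM.
Qed.

End DotProduct.

Lemma dot_mulmx (R : realType) m n (x : 'rV[R]_m) (y : 'rV[R]_n)
  (B : 'M[R]_(m, n)) : dot (x *m B) y = dot x (y *m B^T).
Proof.
rewrite /dot; under eq_bigr do rewrite mxE mulr_suml.
rewrite exchange_big; apply: eq_bigr => i _ /=.
rewrite mxE mulr_sumr; apply: eq_bigr => j _.
by rewrite [B^T _ _]mxE mulrA mulrAC.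
Qed.

Lemma closed_preimage (T U : topologicalType) (f : T -> U) (D : set U) :
  continuous f -> closed D -> closed (f @^-1` D).
Proof. by move=> cf; apply: preimage_closed => x _; exact: cf. Qed.

(** * Closed cones and compactness of their slices *)

Section Cones.
Context {R : realType} {n : nat}.
Implicit Types (K : set 'rV[R]_n) (f u x y : 'rV[R]_n).

Definition closed_cone K :=
  [/\ K 0, forall x y, K x -> K y -> K (x + y),
      forall a x, 0 <= a -> K x -> K (a *: x) & closed K].

Definition nonneg_on K f := forall x, K x -> 0 <= dot f x.

Definition pos_on K f := forall x, K x -> x != 0 -> 0 < dot f x.

Lemma nonneg_onD K f g : nonneg_on K f -> nonneg_on K g -> nonneg_on K (f + g).
Proof. by move=> f0 g0 x Kx; rewrite dotDl addr_ge0 ?f0 ?g0. Qed.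

Lemma nonneg_onZ K a f : 0 <= a -> nonneg_on K f -> nonneg_on K (a *: f).
Proof. by move=> a0 f0 x Kx; rewrite dotZl mulr_ge0 ?f0. Qed.

Lemma pos_onW K f : pos_on K f -> nonneg_on K f.
Proof.
move=> f0 x Kx; have [->|x0] := eqVneq x 0; first by rewrite dot0r.
exact/ltW/f0.
Qed.

Lemma closed_dot_eq f a : closed [set x | dot f x = a].
Proof.
apply: (@closed_preimage _ R^o (dot f) [set a]); last exact: closed_eq.
by apply: continuous_dot => x; [exact: cst_continuous | exact: cvg_id].
Qed.

Lemma closed_dot_le f a : closed [set x | dot f x <= a].
Proof.
apply: (@closed_preimage _ R^o (dot f) [set t | t <= a]); last exact: closed_le.
by apply: continuous_dot => x; [exact: cst_continuous | exact: cvg_id].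
Qed.

Lemma closed_dot_ge f a : closed [set x | a <= dot f x].
Proof.
apply: (@closed_preimage _ R^o (dot f) [set t | a <= t]); last exact: closed_ge.
by apply: continuous_dot => x; [exact: cst_continuous | exact: cvg_id].
Qed.

(** On the Euclidean unit vectors of K the functional [u] has a positive minimum, so by homogeneity
    [u] bounds the norm on K. *)
Lemma slice_compact K u M : closed_cone K -> pos_on K u ->
  compact [set x | K x /\ dot u x <= M].
Proof.
move=> [K0 KD KZ clK] u_gt0.
have clS : closed (K `&` [set x | dot u x <= M]).
  by apply: closedI => //; exact: closed_dot_le.
have cS : continuous (fun x : 'rV[R]_n => dot x x).
  by apply: continuous_dot => x; exact: cvg_id.
pose S := K `&` [set x | dot x x = 1].
have compS : compact S.
  apply: (@closed_coord_bounded_compact _ _ _ 1).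
    apply: closedI => //; apply: (@closed_preimage _ R^o _ [set 1] cS).
    exact: closed_eq.
  move=> x [_ /= x1] i; rewrite -(ler_pXn2r (n := 2)) ?nnegrE// expr1n.
  by rewrite -normrX ger0_norm ?sqr_ge0// -x1 coord_le_dot.
have [S0|/set0P S0] := eqVneq S set0.
  have Kx0 x : K x -> x = 0.
    move=> Kx; apply/eqP; apply: contrapT => /negP x0.
    have xx0 := dot_gt0 x0.
    suff : S ((Num.sqrt (dot x x))^-1 *: x) by rewrite S0.
    split; first by apply: KZ => //; rewrite invr_ge0 sqrtr_ge0.
    rewrite /= dotZl dotZr mulrA -expr2 exprVn sqr_sqrtr ?ltW//.
    by rewrite mulVf ?gt_eqF.
  apply: (@closed_coord_bounded_compact _ _ _ 0 clS) => x [/Kx0 -> _] i.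
  by rewrite mxE normr0.
have cu : continuous (fun x : 'rV[R]_n => dot u x).
  by apply: continuous_dot => x; [exact: cst_continuous | exact: cvg_id].
have [p /set_mem [Kp p1] pmin] :=
  compact_EVT_min S0 compS (continuous_subspaceT cu).
have m0 : 0 < dot u p.
  by apply: u_gt0 => //; rewrite -dot_eq0 p1 oner_eq0.
apply: (@closed_coord_bounded_compact _ _ _ (`|M| / dot u p) clS).
move=> x [Kx uxM] i; have [->|x0] := eqVneq x 0.
  by rewrite mxE normr0 divr_ge0 ?normr_ge0 ?ltW.
have xx0 := dot_gt0 x0; set r := Num.sqrt (dot x x).
have r0 : 0 < r by rewrite sqrtr_gt0.
have r2 : r ^+ 2 = dot x x by rewrite sqr_sqrtr ?ltW.
have Sx : S (r^-1 *: x).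
  split; first by apply: KZ => //; rewrite invr_ge0 ltW.
  by rewrite /= dotZl dotZr mulrA -expr2 exprVn r2 mulVf ?gt_eqF.
have := pmin _ (mem_set Sx).
rewrite dotZr ler_pdivlMl// => le_r.
rewrite ler_pdivlMr//; apply: (@le_trans _ _ (r * dot u p)).
  rewrite ler_pM2r// -(ler_pXn2r (n := 2)) ?nnegrE ?(ltW r0)// r2.
  by rewrite -normrX ger0_norm ?sqr_ge0// coord_le_dot.
by rewrite (le_trans le_r)// (le_trans uxM)// ler_norm.
Qed.

End Cones.

(** * Separation of cones and existence of exposed rays *)

Section Separation.
Context {R : realType} {n : nat}.
Implicit Types (K E : set 'rV[R]_n) (f u x y p : 'rV[R]_n).

(** The point q of E nearest to p exists because E may be cut down to a ball around p. A negative
    inner product would let a step from q towards x come closer to p. *)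
Lemma nearest_point E p : E !=set0 -> closed E ->
  (forall x y t, E x -> E y -> 0 <= t <= 1 -> E (x + t *: (y - x))) ->
  exists2 q, E q & forall x, E x -> 0 <= dot (q - p) (x - q).
Proof.
move=> [e Ee] clE convE.
pose d x := dot (x - p) (x - p).
have cd : continuous d.
  have cB : continuous (fun x : 'rV[R]_n => x - p).
    by move=> x; apply: continuousB; [exact: cvg_id | exact: cst_continuous].
  exact: continuous_dot.
pose E' := E `&` [set x | d x <= d e].
have cE' : compact E'.
  (* The term [1 + d e] bounds any number of square at most [d e], because a <= 1 + a^2. *)
  apply: (@closed_coord_bounded_compact _ _ _ (1 + d e + \sum_i `|p 0 i|)).
    apply: closedI => //.
    apply: (@closed_preimage _ R^o d [set t | t <= d e] cd).
    exact: closed_le.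
  move=> x [_ /= xe] i.
  have -> : x 0 i = (x - p) 0 i + p 0 i by rewrite !mxE subrK.
  apply: (le_trans (ler_normD _ _)); apply: lerD; last first.
    by rewrite (bigD1 i)//= lerDl sumr_ge0.
  have := le_trans (coord_le_dot (x - p) i) xe.
  have := le_trans (coord_le_dot (x - p) i) xe.
  rewrite -(real_normK (num_real ((x - p) 0 i))).
  move: `|(x - p) 0 i| => a; move: (d e) => b ab.
  have := sqr_ge0 (a - 1); have := sqr_ge0 a.
  by rewrite sqrrB expr1n mulr1; lra.
have [q /set_mem [Eq qe] qmin] :
    exists2 q, q \in E' & forall x, x \in E' -> d q <= d x.
  apply: compact_EVT_min => //; first by exists e; split => //=.
  exact: continuous_subspaceT.
have {}qmin x : E x -> d q <= d x.
  move=> Ex; have [xe|/ltW ex] := leP (d x) (d e).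
    by apply: qmin; apply: mem_set.
  exact: le_trans ex.
exists q => // x Ex; rewrite leNgt; apply/negP => a0.
set a := dot (q - p) (x - q) in a0.
pose b := dot (x - q) (x - q); have b0 : 0 <= b := dot_ge0 _.
have ba0 : 0 < b - a by lra.
(* As a < 0 <= b, this t is in (0, 1] even for b = 0, and 2 a + t b is negative. *)
pose t := - a / (b - a).
have t0 : 0 < t by rewrite divr_gt0 ?oppr_gt0.
have t1 : t <= 1 by rewrite ler_pdivrMr// mul1r; lra.
have tba : t * (b - a) = - a by rewrite divfK ?gt_eqF.
have /qmin : E (q + t *: (x - q)) by apply: convE; rewrite // (ltW t0).
have -> : d (q + t *: (x - q)) = d q + t * (2 * a + t * b).
  rewrite /d addrAC /a /b; move: (q - p) (x - q) => v w.
  by rewrite dotDl !dotDr dotZl !dotZr dotZl [dot w v]dotC; ring.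
rewrite lerDl pmulr_rge0// => h.
have : 0 <= (2 * a + t * b) * (b - a) by rewrite mulr_ge0 ?(ltW ba0).
have -> : (2 * a + t * b) * (b - a) = a * (b - 2 * a).
  by rewrite mulrDl mulrAC [t * b * _]mulrAC tba; ring.
nra.
Qed.

(** For q nearest to p in K, the functional q - p is nonnegative on K since q + x stays in K;
    comparing q with 0 gives its sign at p. *)
Lemma cone_separation K p : closed_cone K -> ~ K p ->
  exists2 f, nonneg_on K f & dot f p < 0.
Proof.
move=> [K0 KD KZ clK] Kp.
have [|x y t Kx Ky /andP[t0 t1]|q Kq qmin] := @nearest_point K p _ clK.
- by exists 0.
- have -> : x + t *: (y - x) = (1 - t) *: x + t *: y.
    by rewrite scalerBr scalerBl scale1r addrAC addrA.
  by apply: KD; apply: KZ => //; rewrite subr_ge0.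
exists (q - p).
  move=> x Kx; have := qmin _ (KD _ _ Kq Kx).
  by rewrite addrAC subrr add0r.
have qp : q - p != 0 by rewrite subr_eq0; apply: contra_notN Kp => /eqP <-.
have := qmin 0 K0; have := dot_gt0 qp.
by rewrite sub0r dotNr [X in 0 < X]dotBr; lra.
Qed.

Lemma exists_spanning_rows (P : set 'rV[R]_n) :
  exists k, exists B : 'M[R]_(k, n),
    [/\ row_free B, forall i, P (row i B) & forall p, P p -> (p <= B)%MS].
Proof.
pose Q k := `[< exists2 B : 'M[R]_(k, n), row_free B & forall i, P (row i B) >].
have Q0 : exists k, Q k.
  exists 0%N; apply/asboolP; exists 0; first by rewrite /row_free mxrank0.
  by case.
have Qn k : Q k -> (k <= n)%N.
  by move=> /asboolP[B /eqP rB _]; rewrite -rB rank_leq_col.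
case: (ex_maxnP Q0 Qn) => k /asboolP[B Bfree BP] kmax.
exists k, B; split => // p Pp; apply: contrapT => pB.
suff /kmax : Q (k + 1)%N by rewrite addn1 ltnn.
apply/asboolP; exists (col_mx B p); last first.
  move=> i; case: (split_ordP i) => j ->; first by rewrite rowKu.
  by rewrite rowKd [j]ord1 row_id.
rewrite /row_free eqn_leq rank_leq_row -addsmxE addn1 -{1}(eqP Bfree).
apply: rank_ltmx.
rewrite ltmxE addsmxSl /=; apply/negP => BpB; apply: pB.
by apply: submx_trans BpB; exact: addsmxSr.
Qed.

(** Take the sum of functionals that span the dual cone: if it vanishes at x in K, so does every
    functional nonnegative on K, and - x cannot be separated from K. *)
Lemma exists_pos_on K : closed_cone K -> (forall x, K x -> K (- x) -> x = 0) ->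
  exists u, pos_on K u.
Proof.
move=> ccK ptK.
have [k [B [_ Bpos Bspan]]] := exists_spanning_rows (nonneg_on K).
exists (\sum_i row i B) => x Kx x0; rewrite lt_def dot_suml sumr_ge0 ?andbT;
  last by move=> i _; exact: Bpos.
apply: contraNneq x0 => /eqP.
rewrite psumr_eq0 => [/allP Bx|i _]; last exact: Bpos.
apply/eqP/ptK => //; apply: contrapT => /(cone_separation ccK)[f fpos].
have /submxP[c ->] := Bspan _ fpos.
rewrite dotNr oppr_lt0 dot_mulmx.
suff -> : x *m B^T = 0 by rewrite dot0r ltxx.
apply/rowP => i; rewrite mulmx_tr_dot dotC mxE.
exact/eqP/Bx/mem_index_enum.
Qed.

Definition exposed K x := exists2 f, nonneg_on K f &
  dot f x = 0 /\ forall y, K y -> dot f y = 0 -> exists c, y = c *: x.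

(* Over the compact slice u = 1, a maximizer of |x|^2 + 2 r <h, x> is exposed by
   the linearization of this strictly convex function; r is chosen large enough
   to force <h, x> > 0. *)
Lemma exists_exposed K h x0 : closed_cone K ->
    (forall x, K x -> K (- x) -> x = 0) -> K x0 -> 0 < dot h x0 ->
  exists x, [/\ K x, exposed K x & 0 < dot h x].
Proof.
move=> ccK ptK; have [u upos] := exists_pos_on ccK ptK.
have [K0 KD KZ clK] := ccK => Kx0 hx0.
have ux0 : 0 < dot u x0.
  by apply: upos => //; apply: contraTneq hx0 => ->; rewrite dot0r ltxx.
pose y0 := (dot u x0)^-1 *: x0.
have hy0 : 0 < dot h y0 by rewrite dotZr mulr_gt0 ?invr_gt0.
pose S := [set x | K x /\ dot u x <= 1] `&` [set x | dot u x = 1].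
have compS : compact S.
  by apply: compact_closedI; [exact: slice_compact | exact: closed_dot_eq].
have Sy0 : S y0.
  have uy0 : dot u y0 = 1 by rewrite dotZr mulVf ?gt_eqF.
  split; rewrite /= uy0 //; split => //.
  by apply: KZ => //; rewrite invr_ge0 ltW.
have S0 : S !=set0 by exists y0.
have cid : continuous (fun x : 'rV[R]_n => x) by move=> x; exact: cvg_id.
have ccst (v : 'rV[R]_n) : continuous (fun _ : 'rV[R]_n => v).
  by move=> x; exact: cst_continuous.
have [m /set_mem Sm mmax] := compact_EVT_max S0 compS
  (continuous_subspaceT (continuous_dot cid cid)).
(* With this [r], h p <= 0 would make the maximum at most |m|^2, while the value at [y0] is |y0|^2 +
   2 |m|^2. *)
have [r r0 rhy0] : exists2 r, 0 <= r & r * dot h y0 = dot m m.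
  exists (dot m m / dot h y0); first by rewrite divr_ge0 ?dot_ge0 ?ltW.
  by rewrite divfK ?gt_eqF.
have [p /set_mem Sp pmax] := compact_EVT_max S0 compS
  (continuous_subspaceT (continuous_dot cid
    (fun x => cvgD (cid x) (ccst ((2 * r) *: h) x)))).
have {mmax} mmax x : S x -> dot x x <= dot m m by move=> ?; exact/mmax/mem_set.
have {pmax} pmax x : S x ->
    dot x x + 2 * r * dot h x <= dot p p + 2 * r * dot h p.
  move=> /mem_set/pmax; rewrite !dotDr !dotZr.
  by rewrite [dot x h]dotC [dot p h]dotC.
have [[Kp _] /= up] := Sp.
have hp : 0 < dot h p.
  have y0n0 : y0 != 0 by apply: contraTneq hy0 => ->; rewrite dot0r ltxx.
  rewrite ltNge; apply/negP => hp0.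
  have rhp : r * dot h p <= 0 by rewrite mulr_ge0_le0.
  have := dot_gt0 y0n0; have := pmax _ Sy0; have := mmax _ Sp.
  by have := dot_ge0 m; rewrite -!mulrA; lra.
(* [l] is the gradient at [p] of the maximized function. On the slice [f] is l p - l y, and the
   quadratic term leaves a gap of |y - p|^2. *)
pose l := 2 *: p + (2 * r) *: h.
pose f := dot l p *: u - l.
have fS y : S y -> dot (y - p) (y - p) <= dot f y.
  move=> Sy; have [_ /= uy] := Sy; have := pmax _ Sy.
  have -> : dot f y = dot l p - dot l y by rewrite dotBl dotZl uy mulr1.
  by rewrite !(dotDl, dotZl, dotDr, dotNl, dotNr) [dot y p]dotC; lra.
have KS y : K y -> y != 0 -> exists2 y1, S y1 & y = dot u y *: y1.
  move=> Ky yn0; have uy := upos _ Ky yn0.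
  exists ((dot u y)^-1 *: y).
    have uy1 : dot u ((dot u y)^-1 *: y) = 1 by rewrite dotZr mulVf ?gt_eqF.
    split; rewrite /= uy1 //; split => //.
    by apply: KZ => //; rewrite invr_ge0 ltW.
  by rewrite scalerA divff ?gt_eqF// scale1r.
exists p; split => //; exists f; last split.
- move=> y Ky; have [->|yn0] := eqVneq y 0; first by rewrite dot0r.
  have uy := upos _ Ky yn0.
  have [y1 Sy1 ->] := KS _ Ky yn0.
  by rewrite dotZr mulr_ge0 ?(ltW uy)// (le_trans _ (fS _ Sy1))// dot_ge0.
- by rewrite /f dotBl dotZl up mulr1 subrr.
move=> y Ky; have [->|yn0] := eqVneq y 0; first by exists 0; rewrite scale0r.
have uy := upos _ Ky yn0.
have [y1 Sy1 ->] := KS _ Ky yn0.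
rewrite dotZr => /eqP; rewrite mulf_eq0 gt_eqF//= => /eqP fy1.
exists (dot u y); congr (_ *: _); apply/eqP; rewrite -subr_eq0 -dot_eq0.
by rewrite eq_le dot_ge0 andbT -fy1 fS.
Qed.

End Separation.

Lemma mulmxr_continuous (R : realType) n p (B : 'M[R]_(n, p)) :
  continuous (fun x : 'rV[R]_n => x *m B).
Proof.
move=> x; have fx : Filter (nbhs x) by exact: nbhs_filter.
have ffx : Filter ((fun y : 'rV[R]_n => y *m B) @ x) by exact: fmap_filter.
apply/(@cvg_mx_entourageP R 1 p _ ffx) => A entA.
have cj j : continuous (fun y : 'rV[R]_n => (y *m B) 0 j).
  rewrite (_ : (fun _ => _) = (fun y => dot y (row j B^T))).
    by apply: continuous_dot => y; [exact: cvg_id | exact: cst_continuous].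
  by apply/funext => y; rewrite -mulmx_tr_dot trmxK.
have near_j j : \forall y \near x, ((x *m B) 0 j, (y *m B) 0 j) \in A.
  have /cvg_entourageP/(_ A entA) := cj j x.
  by move=> h; apply: (@filterS _ (nbhs x) fx _ _ _ h) => y /mem_set.
have nj := @filter_forall _ _ _ (nbhs x) fx near_j.
near=> y => i j; rewrite [i]ord1; move: j; near: y; exact: nj.
Unshelve. all: by end_near. Qed.

(** * Extremal chords and parallel supporting hyperplanes *)

Section Antipodal.
Context {R : realType} {n : nat}.
Implicit Types (K : set 'rV[R]_n) (f u x y p : 'rV[R]_n).

Lemma eq_dot_submx m (A : 'M[R]_(m, n)) f g w :
  (forall i, dot f (row i A) = dot g (row i A)) -> (w <= A)%MS ->
  dot f w = dot g w.
Proof.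
move=> fg /submxP[c ->]; rewrite ![dot _ (c *m A)]dotC !dot_mulmx.
by congr dot; apply/rowP => i; rewrite !mulmx_tr_dot.
Qed.

Lemma closed_cone_dual K : closed_cone (nonneg_on K).
Proof.
split=> [x _||a f|]; first by rewrite dot0l.
- exact: nonneg_onD.
- exact: nonneg_onZ.
have -> : nonneg_on K = \bigcap_(x in K) [set f | 0 <= dot x f].
  by apply/seteqP; split=> f /= f0 x /f0 /=; rewrite dotC.
by apply: closed_bigI => x _; exact: closed_dot_ge.
Qed.

Lemma slice_eq_compact K u a : closed_cone K -> pos_on K u ->
  compact (K `&` [set x | dot u x = a]).
Proof.
move=> ccK upos; have [_ _ _ clK] := ccK.
apply: (@subclosed_compact _ _ [set x | K x /\ dot u x <= a]);
  last 2 first.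
- exact: slice_compact.
- by move=> x [Kx /= ->].
- by apply: closedI => //; exact: closed_dot_eq.
Qed.

(** By compactness of the slice u = 1; hence a small multiple of h can be added to u without losing
    nonnegativity on K. *)
Lemma pos_on_dominates K u h : closed_cone K -> pos_on K u ->
  exists2 M, 0 < M & forall x, K x -> `|dot h x| <= M * dot u x.
Proof.
move=> ccK upos; have [K0 KD KZ clK] := ccK.
have compS := slice_eq_compact (a := 1) ccK upos; set S := _ `&` _ in compS.
have cid : continuous (fun x : 'rV[R]_n => x) by move=> x; exact: cvg_id.
have cu : continuous (fun x : 'rV[R]_n => dot h x).
  by apply: continuous_dot => // x; exact: cst_continuous.
have [M M0 MS] : exists2 M, 0 < M & forall x, S x -> `|dot h x| <= M.
  have /ex_strict_bound_gt0[M M0 MS] :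
      bounded_set ((fun x => dot h x : R^o) @` S).
    by apply: compact_bounded; apply: continuous_compact => //;
      exact: continuous_subspaceT.
  by exists M => // x Sx; apply/ltW/MS; exists x.
exists M => // x Kx; have [->|x0] := eqVneq x 0.
  by rewrite !dot0r normr0 mulr0.
have ux := upos _ Kx x0.
have /MS : S ((dot u x)^-1 *: x).
  split; last by rewrite /= dotZr mulVf ?gt_eqF.
  by apply: KZ => //; rewrite invr_ge0 ltW.
by rewrite dotZr normrM gtr0_norm ?invr_gt0// ler_pdivrMl// mulrC.
Qed.

(** A linear programming duality. Modulo the row space of A the slice u <= a has a compact convex
    image; if it missed the class of - x0, its nearest point would give a direction [h] in which [u]
    can be moved past the assumed bound. *)
Lemma reach_subspace K u m (A : 'M[R]_(m, n)) x0 (a : R) :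
    closed_cone K -> pos_on K u -> 0 < a ->
    (forall f, nonneg_on K f -> (forall i, dot f (row i A) = 0) -> f = 0) ->
    (forall f, nonneg_on K f ->
      (forall i, dot f (row i A) = dot u (row i A)) ->
      dot f x0 <= dot u x0 + a) ->
  exists y, [/\ K y, dot u y <= a & ((x0 + y)%R <= A)%MS].
Proof.
move=> ccK upos a0 Aint x0max; have [K0 KD KZ clK] := ccK.
pose N := cokermx A.
pose E := [set x | K x /\ dot u x <= a].
have compE : compact E by exact: slice_compact.
pose E' := (fun y => y *m N) @` E.
have [_ [y [Ky uy] <-] ymin] : exists2 q, E' q &
    forall x, E' x -> 0 <= dot (q - (- (x0 *m N))) (x - q).
  apply: nearest_point.
  - by exists (0 *m N), 0 => //; split => //; rewrite dot0r ltW.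
  - apply: compact_closed; first exact: norm_hausdorff.
    apply: continuous_compact => //; apply: continuous_subspaceT.
    exact: mulmxr_continuous.
  move=> _ _ t [v [Kv uv] <-] [w [Kw uw] <-] /andP[t0 t1].
  exists ((1 - t) *: v + t *: w); last first.
    by rewrite mulmxDl -!scalemxAl scalerBr scalerBl scale1r addrAC addrA.
  split; first by apply: KD; apply: KZ => //; rewrite subr_ge0.
  rewrite dotDr !dotZr.
  have := ler_wpM2l t0 uw; have : (1 - t) * dot u v <= (1 - t) * a.
    by rewrite ler_wpM2l// subr_ge0.
  lra.
exists y; split => //; rewrite submxE; apply/eqP; apply: contrapT => /eqP v0.
set v := (x0 + y) *m cokermx A in v0.
have vE : y *m N - - (x0 *m N) = v by rewrite opprK addrC -mulmxDl.
rewrite vE in ymin.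
pose h := v *m N^T.
have hE x : dot h x = dot v (x *m N) by rewrite dot_mulmx trmxK.
have hA i : dot h (row i A) = 0.
  by rewrite hE -row_mul mulmx_coker row0 dot0r.
have hmin x : K x -> dot u x <= a -> dot h y <= dot h x.
  move=> Kx ux; rewrite !hE -subr_ge0 -dotBr; apply: ymin.
  by exists x.
have hxy : 0 < dot h x0 + dot h y.
  by rewrite -dotDr hE dot_gt0.
have hy0 : dot h y <= 0.
  by rewrite -(dot0r h); apply: hmin => //; rewrite dot0r ltW.
have hlow x : K x -> dot h y * dot u x <= a * dot h x.
  move=> Kx; have [->|xn0] := eqVneq x 0; first by rewrite !dot0r !mulr0.
  have ux := upos _ Kx xn0.
  rewrite -ler_pdivlMr// mulrAC -dotZr; apply: hmin.
    by apply: KZ => //; rewrite divr_ge0 ?ltW.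
  by rewrite dotZr divfK ?gt_eqF.
(* If [h] vanishes at [y], then it is nonnegative on K and zero on A, hence zero. *)
have {hy0} [hy0|hy0] : dot h y = 0 \/ dot h y < 0.
  by move: hy0; rewrite le_eqVlt => /orP[/eqP|]; [left | right].
  have h0 : h = 0.
    apply: Aint => // x /hlow.
    by rewrite hy0 mul0r pmulr_rge0.
  by move: hxy; rewrite h0 !dot0l addr0 ltxx.
have m0 : 0 < - dot h y by rewrite oppr_gt0.
(* By [hlow] this functional is nonnegative on K, and it agrees with [u] on A; the bound at [x0]
   then contradicts [hxy]. *)
have := x0max (u + (a / (- dot h y)) *: h).
rewrite !dotDl !dotZl lerD2l => x0m.
have := x0m _ _; rewrite mulrAC ler_pdivrMr// ler_pM2l// => x0m'.
have : dot h x0 <= - dot h y; last by move: hxy; lra.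
apply: x0m'.
  move=> x Kx; rewrite dotDl dotZl mulrAC.
  rewrite -[dot u x](mulfK (lt0r_neq0 m0)) -mulrDl divr_ge0 ?(ltW m0)//.
  by have := hlow _ Kx; rewrite mulrC mulrN; lra.
by move=> i; rewrite dotDl dotZl hA mulr0 addr0.
Qed.


(* Maximizing g(x) over the functionals g >= 0 on K that agree with u on the
   rows of A, and over the x in K with u(x) = 1, gives the chord of extremal
   ratio: x3 is the maximizer, f4 the maximizing functional divided by its
   value. *)
Lemma antipodal_support K u m (A : 'M[R]_(m, n)) h x0 :
    closed_cone K -> pos_on K u -> (forall i, K (row i A)) ->
    (forall f, nonneg_on K f -> (forall i, dot f (row i A) = 0) -> f = 0) ->
    (forall i, dot h (row i A) = 0) -> K x0 -> dot h x0 != 0 ->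
  exists f3, exists f4, exists x3, exists x4,
  [/\ [/\ nonneg_on K f3, nonneg_on K f4, f3 + f4 = u, K x3 & K x4],
      [/\ x3 != 0, dot f3 x3 = 0, dot f4 x4 = 0 & ((x3 + x4)%R <= A)%MS] &
      exists2 c, 0 < c < 1 &
        forall w, (w <= A)%MS -> dot f3 w = c * dot u w].
Proof.
move=> ccK upos KA Aint hA Kx0 hx0; have [K0 KD KZ clK] := ccK.
have unneg := pos_onW upos.
(* The sum of the rows is positive on the nonzero elements of the dual cone, so fixing the values on
   A leaves a compact set of functionals. *)
pose e := \sum_i row i A.
have epos : pos_on (nonneg_on K) e.
  move=> f fnn fn0; rewrite lt_def dot_suml sumr_ge0 ?andbT; last first.
    by move=> i _; rewrite dotC fnn.
  apply: contraNneq fn0 => /eqP.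
  rewrite psumr_eq0 => [/allP ef|i _]; last by rewrite dotC fnn.
  by apply/eqP/Aint => // i; rewrite dotC; apply/eqP/ef/mem_index_enum.
pose P := nonneg_on K `&`
  [set f | forall i, dot f (row i A) = dot u (row i A)].
have compP : compact P.
  apply: (@subclosed_compact _ _
    (nonneg_on K `&` [set f | dot e f = dot e u])); last 2 first.
  - exact: slice_eq_compact (closed_cone_dual K) epos.
  - move=> f [fnn /= fA]; split => //=.
    by rewrite !dot_suml; apply: eq_bigr => i _; rewrite dotC fA dotC.
  apply: closedI; first by have [] := closed_cone_dual K.
  rewrite (_ : [set _ | _] = \bigcap_(i in setT)
    [set f | dot (row i A) f = dot (row i A) u]).
    by apply: closed_bigI => i _; exact: closed_dot_eq.
  apply/seteqP; split=> f /= fA i; first by move=> _ /=; rewrite dotC fA dotC.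
  by rewrite dotC (fA i I) dotC.
pose S := K `&` [set x | dot u x = 1].
have compS : compact S by exact: slice_eq_compact.
have normS x : K x -> x != 0 -> S ((dot u x)^-1 *: x).
  move=> Kx xn0; have ux := upos _ Kx xn0.
  split; first by apply: KZ => //; rewrite invr_ge0 ltW.
  by rewrite /= dotZr mulVf ?gt_eqF.
have x0n0 : x0 != 0 by apply: contraNneq hx0 => ->; rewrite dot0r.
have Pu : P u by split.
have [[f x3] /set_mem [/= Pf Sx3] fmax] :
    exists2 q, q \in P `*` S & forall t, t \in P `*` S ->
      dot t.1 t.2 <= dot q.1 q.2.
  apply: compact_EVT_max.
  - by exists (u, (dot u x0)^-1 *: x0); split => //=; exact: normS.
  - exact: compact_setX.
  apply: continuous_subspaceT.
  apply: continuous_dot => z; [exact: cvg_fst | exact: cvg_snd].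
have {}fmax g x : P g -> S x -> dot g x <= dot f x3.
  by move=> Pg Sx; apply: (fmax (g, x)); apply: mem_set.
have [[fnn fA] [Kx3 /= ux3]] := (Pf, Sx3).
set L := dot f x3 in fmax.
have fL x : K x -> dot f x <= L * dot u x.
  move=> Kx; have [->|xn0] := eqVneq x 0; first by rewrite !dot0r mulr0.
  have ux := upos _ Kx xn0.
  by rewrite -ler_pdivrMr// mulrC -dotZr fmax//; exact: normS.
(* Adding to [u] a small multiple of [h], with the right sign, stays in [P] and raises the value at
   the normalized [x0] above 1. *)
have L1 : 1 < L.
  have ux0 := upos _ Kx0 x0n0.
  wlog hx0pos : h hA hx0 / 0 < dot h x0.
    move=> H; move: (hx0); rewrite neq_lt => /orP[h0|]; last exact: H.
    by apply: (H (- h)) => [i||]; rewrite dotNl ?hA ?oppr0 ?oppr_eq0 ?oppr_gt0.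
  have [M M0 hM] := pos_on_dominates h ccK upos.
  have Pg : P (u + M^-1 *: h).
    split=> [x Kx|i] /=; last by rewrite dotDl dotZl hA mulr0 addr0.
    rewrite dotDl dotZl -(ler_pM2l M0) mulr0 mulrDr mulVKf ?gt_eqF//.
    by have := hM _ Kx; rewrite ler_norml => /andP[]; lra.
  have := fmax _ _ Pg (normS _ Kx0 x0n0); apply: lt_le_trans.
  rewrite !(dotDl, dotZl, dotZr) mulVf ?gt_eqF// ltrDl.
  by rewrite !mulr_gt0 ?invr_gt0.
have L0 : 0 < L by lra.
have [y [Ky uy x3y]] : exists y,
    [/\ K y, dot u y <= L - 1 & ((x3 + y)%R <= A)%MS].
  apply: (reach_subspace (u := u)) => //; first by rewrite subr_gt0.
  by move=> g gnn gA; rewrite ux3 addrC subrK; apply: fmax.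
(* As [f] and [u] agree on x3 + y, L + f y = 1 + u y <= L. *)
have fy : dot f y = 0.
  have := eq_dot_submx fA x3y; rewrite !dotDr ux3 -/L => fuy.
  by apply/eqP; rewrite eq_le fnn// andbT; lra.
exists (u - L^-1 *: f), (L^-1 *: f), x3, y; split; first split => //.
- move=> x Kx; rewrite dotBl dotZl subr_ge0 ler_pdivrMl//; exact: fL.
- by apply: nonneg_onZ => //; rewrite invr_ge0 ltW.
- by rewrite subrK.
- split => //.
  + by apply: contra_eq_neq ux3 => ->; rewrite dot0r eq_sym oner_eq0.
  + by rewrite dotBl dotZl ux3 -/L mulVf ?gt_eqF// subrr.
  + by rewrite dotZl fy mulr0.
exists (1 - L^-1).
  by rewrite subr_gt0 invf_lt1// L1/= ltrBlDr ltrDl invr_gt0.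
by move=> w wA; rewrite dotBl dotZl (eq_dot_submx fA wA); ring.
Qed.

End Antipodal.

(** * Faces and kites *)

Section Sandwich.
Context {R : realType}.

Definition face (V : vectType R) (C F : set V) :=
  [/\ F `<=` C, F 0, is_cone F &
      forall a b, C a -> C b -> F (a + b) -> F a].

(* F is a face of the cone of interest: the functionals need not be
   nonnegative on the whole cone. *)
Record kite (V : vectType R) (F : set V) (x1 x2 x3 x4 : V)
    (f1 f2 f3 f4 : dual V) : Prop := Kite {
  kite_mem : [/\ F x1, F x2, F x3 & F x4];
  kite_dual : [/\ dual_cone F f1, dual_cone F f2,
                  dual_cone F f3 & dual_cone F f4];
  kite_neq0 : x1 != 0;
  kite_sum : x1 + x2 = x3 + x4;
  kite_dual_sum : f1 + f2 = f3 + f4;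
  kite_vanish : [/\ f1 x1 = 0, f2 x2 = 0, f3 x3 = 0 & f4 x4 = 0];
  kite_corner : forall a, F a -> f1 a = 0 -> f3 a = 0 \/ f4 a = 0 -> a = 0 }.

(** The kite may lie in a proper face, which lets the induction on the dimension pass to faces. *)
Definition sandwiched (V : vectType R) (C : set V) :=
  exists2 F, face C F &
    exists x1 x2 x3 x4 f1 f2 f3 f4, kite F x1 x2 x3 x4 f1 f2 f3 f4.

Lemma is_coneD (V : vectType R) (C : set V) x y :
  is_cone C -> C x -> C y -> C (x + y).
Proof.
move=> coneC Cx Cy; have := coneC _ _ 1 1 Cx Cy ler01 ler01.
by rewrite !scale1r.
Qed.

Lemma is_coneZ (V : vectType R) (C : set V) a x :
  is_cone C -> 0 <= a -> C x -> C (a *: x).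
Proof.
move=> coneC a0 Cx; have := coneC _ _ a 0 Cx Cx a0 (lexx 0).
by rewrite scale0r addr0.
Qed.

Lemma face_refl (V : vectType R) (C : set V) : is_cone C -> C 0 -> face C C.
Proof. by move=> coneC C0; split. Qed.

Lemma sandwiched_face (V : vectType R) (C F : set V) :
  face C F -> sandwiched F -> sandwiched C.
Proof.
move=> [FC F0 coneF faceF] [G [GF G0 coneG faceG] kG].
exists G => //; split => // [x /GF/FC//|a b Ca Cb Gab].
have Fab := GF _ Gab.
apply: faceG Gab; first exact: faceF Fab.
by rewrite addrC in Fab; exact: faceF Fab.
Qed.

(** Functionals are transported by the left inverse of [g]. As [g] need not be onto, this covers
    both coordinates and the restriction to a subspace containing C. *)
Lemma sandwiched_preimage (V W : vectType R) (g : 'Hom(V, W)) (C : set W) :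
  lker g == 0%VS -> (forall y, C y -> exists x, y = g x) ->
  sandwiched (g @^-1` C) -> sandwiched C.
Proof.
move=> g0 Cg [F [FC F0 coneF faceF]
  [x1 [x2 [x3 [x4 [f1 [f2 [f3 [f4 [Fx Ff x1n0 xE fE f0 corner]]]]]]]]]].
have gK := lker0_lfunK g0.
exists (g @` F).
  split.
  - by move=> _ [x Fx' <-]; exact: FC.
  - by exists 0; rewrite ?linear0.
  - move=> _ _ s t [x Fx' <-] [y Fy' <-] s0 t0; exists (s *: x + t *: y).
      exact: coneF.
    by rewrite linearD !linearZ.
  - move=> y1 y2 Cy1 Cy2 [z Fz]; move: (Cg _ Cy1) (Cg _ Cy2) => [a aE] [b bE].
    rewrite aE bE in Cy1 Cy2 *; rewrite -linearD => /(lker0P g0) zE.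
    by exists a => //; apply: (faceF a b) => //; rewrite -zE.
have dualg f : dual_cone F f -> dual_cone (g @` F) (f \o g^-1)%VF.
  by move=> Ff' _ [x Fx' <-]; rewrite comp_lfunE gK; exact: Ff'.
exists (g x1), (g x2), (g x3), (g x4), (f1 \o g^-1)%VF, (f2 \o g^-1)%VF,
  (f3 \o g^-1)%VF, (f4 \o g^-1)%VF; split.
- by case: Fx => *; split; apply: imageP.
- by case: Ff => *; split; apply: dualg.
- by rewrite -(linear0 g) (inj_eq (can_inj gK)).
- by rewrite -!linearD xE.
- by rewrite -!comp_lfunDl fE.
- by rewrite !comp_lfunE !gK.
move=> _ [a Fa <-]; rewrite !comp_lfunE gK => fa1 fa34.
by rewrite (corner a) ?linear0.
Qed.

Definition row_dual n (f : 'rV[R]_n) : dual 'rV[R]_n :=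
  linfun (dot f : 'rV[R]_n -> R^o).

Lemma row_dualE n (f x : 'rV[R]_n) : row_dual f x = dot f x.
Proof. by apply: linfunE => a y z; rewrite dotDr dotZr. Qed.

Lemma row_dualD n (f g : 'rV[R]_n) : row_dual (f + g) = row_dual f + row_dual g.
Proof. by apply/lfunP => x; rewrite add_lfunE !row_dualE dotDl. Qed.

(** Allowing k < n lets a cone that spans a proper subspace, such as a face, be simplicial. *)
Definition simplicial n (K : set 'rV[R]_n) :=
  exists k (A : 'M[R]_(k, n)), row_free A /\
    forall x, K x <-> exists2 c : 'rV_k, forall i, 0 <= c 0 i & x = c *m A.

(** Test with h = x N N^T, for N the cokernel matrix of B: its value at x is |x N|^2. *)
Lemma submx_dotP n m (B : 'M[R]_(m, n)) x :
  (forall h, (forall i, dot h (row i B) = 0) -> dot h x = 0) -> (x <= B)%MS.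
Proof.
move=> hx; rewrite submxE -dot_eq0; set v := x *m cokermx B.
have := hx (v *m (cokermx B)^T); rewrite dot_mulmx trmxK -/v => -> // i.
by rewrite dot_mulmx trmxK -row_mul mulmx_coker row0 dot0r.
Qed.

End Sandwich.

(** * Existence of a kite in a non-simplicial cone *)

Section Existence.
Context {R : realType}.

Definition pointed n (K : set 'rV[R]_n) := forall x, K x -> K (- x) -> x = 0.

Definition has_sandwich n := forall K : set 'rV[R]_n,
  closed_cone K -> pointed K -> ~ simplicial K -> sandwiched K.

Lemma closed_coneW n (K : set 'rV[R]_n) : closed_cone K -> is_cone K.
Proof.
by move=> [K0 KD KZ _] x y s t Kx Ky s0 t0; apply: KD; exact: KZ.
Qed.

(** In coordinates on the kernel of f, of dimension n - 1, the cone remains closed, pointed and not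
    simplicial. *)
Lemma sandwiched_hyperplane n (K : set 'rV[R]_n) f :
  (forall m, (m < n)%N -> has_sandwich m) ->
  closed_cone K -> pointed K -> ~ simplicial K ->
  f != 0 -> (forall x, K x -> dot f x = 0) -> sandwiched K.
Proof.
move=> IH [K0 KD KZ clK] ptK nsK fn0 fK.
pose U := kermx f^T; pose B := row_base U.
have rB : (\rank U < n)%N.
  have n0 : (0 < n)%N by case: (n) (f) fn0 => // g; rewrite thinmx0 eqxx.
  by rewrite /U mxrank_ker mxrank_tr rank_rV fn0 ltn_subrL.
have Binj : injective (fun v : 'rV_(\rank U) => v *m B).
  exact/row_free_injr/row_base_free.
pose g := linfun (mulmxr B : 'rV_(\rank U) -> 'rV_n).
have gE v : g v = v *m B by rewrite lfunE.
have KB x : K x -> exists v, x = v *m B.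
  move=> Kx; apply/submxP; rewrite eq_row_base; apply/sub_kermxP.
  by apply/rowP => i; rewrite [i]ord1 mulmx_tr_dot row_id dotC fK ?mxE.
apply: (sandwiched_preimage (g := g)).
- by apply/lker0P => v w; rewrite !gE; exact: Binj.
- by move=> x /KB[v ->]; exists v; rewrite gE.
rewrite (_ : g @^-1` K = [set v | K (v *m B)]); last first.
  by apply/funext => v /=; rewrite gE.
apply: IH => //.
- split=> [|v w Kv Kw|a v a0 Kv|] /=.
  + by rewrite mul0mx.
  + by rewrite mulmxDl; exact: KD.
  + by rewrite -scalemxAl; exact: KZ.
  + by apply: (closed_preimage _ clK); exact: mulmxr_continuous.
- move=> v /= Kv; rewrite mulNmx => /(ptK _ Kv) v0.
  by apply: Binj; rewrite v0 mul0mx.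
move=> [k [A [freeA AK]]]; apply: nsK; exists k, (A *m B); split.
  by rewrite /row_free mxrankMfree ?row_base_free.
move=> x; split=> [/[dup] Kx /KB[v vE]|[c c0 ->]].
  move: Kx; rewrite vE => /AK[c c0 ->]; exists c => //.
  by rewrite (mulmxA c A B).
by rewrite (mulmxA c A B); apply/AK; exists c.
Qed.

(* An exposed vector of a simplicial cone spans an extreme ray, so each
   generator that occurs in x or y is proportional to one of the b i. *)
Lemma simplicial_exposed_sum n (H : set 'rV[R]_n) (I : finType) (P : pred I)
    (b : I -> 'rV[R]_n) (c : I -> R) x y m (A : 'M[R]_(m, n)) :
  simplicial H -> H x -> H y -> (forall i, P i -> H (b i)) ->
  (forall i, P i -> exposed H (b i)) -> (forall i, P i -> (b i <= A)%MS) ->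
  (x + y)%R = \sum_(i | P i) c i *: b i -> (x <= A)%MS.
Proof.
move=> [k [D [freeD DH]]] Hx Hy Hb bexp bA xyE.
have HD j : H (row j D).
  apply/DH; exists (delta_mx 0 j); last by rewrite -rowE.
  by move=> i; rewrite mxE; case: (_ && _).
move: xyE; have [s s0 xE] := (DH x).1 Hx; have [t t0 ->] := (DH y).1 Hy.
rewrite xE -mulmxDl => stE; rewrite mulmx_sum_row.
apply: summx_sub => j _.
have [->|sj0] := eqVneq (s 0 j) 0; first by rewrite scale0r sub0mx.
apply: scalemx_sub.
have /choice[d dP] : forall i, exists e : 'rV_k,
    P i -> (forall j, 0 <= e 0 j) /\ b i = e *m D.
  move=> i; case: (boolP (P i)) => [/Hb /DH[e e0 ->]|_]; last by exists 0.
  by exists e.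
have {}stE : s + t = \sum_(i | P i) c i *: d i.
  apply: (row_free_injr freeD) => /=; rewrite stE mulmx_suml.
  by apply: eq_bigr => i Pi; rewrite -scalemxAl -(dP i Pi).2.
have [i [Pi dij]] : exists i, P i /\ d i 0 j != 0.
  apply: contrapT => /forallNP no.
  have : (s + t) 0 j = 0.
    rewrite stE summxE big1// => i Pi; rewrite mxE.
    have := no i; case: eqVneq => [-> _|_ []//]; by rewrite mulr0.
  rewrite mxE => /eqP; rewrite paddr_eq0 ?s0 ?t0// => /andP[/eqP sj _].
  by rewrite sj eqxx in sj0.
have [f fnn [fb fexp]] := bexp i Pi.
have [d0 bE] := dP i Pi.
have : dot f (row j D) = 0.
  move: fb; rewrite bE mulmx_sum_row dot_sumr => /eqP.
  rewrite psumr_eq0 => [/allP/(_ j (mem_index_enum j))|l _].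
    by rewrite /= dotZr mulf_eq0 (negbTE dij) => /eqP.
  by rewrite dotZr mulr_ge0 ?fnn.
by move=> /(fexp _ (HD j))[a ->]; apply: scalemx_sub; exact: bA.
Qed.

Lemma exposed_face n (K H : set 'rV[R]_n) x :
  H `<=` K -> exposed K x -> exposed H x.
Proof.
move=> HK [f fnn [fx fexp]]; exists f; first by move=> y /HK; exact: fnn.
by split=> // y /HK; exact: fexp.
Qed.

Lemma face_hyperplane n (K : set 'rV[R]_n) f : closed_cone K -> nonneg_on K f ->
  closed_cone (K `&` [set x | dot f x = 0]) /\
  face K (K `&` [set x | dot f x = 0]).
Proof.
move=> [K0 KD KZ clK] fnn.
have cc : closed_cone (K `&` [set x | dot f x = 0]).
  split.
  - by split; rewrite //= dot0r.
  - move=> x y [Kx /= fx] [Ky /= fy]; split; first exact: KD.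
    by rewrite /= dotDr fx fy addr0.
  - move=> a x a0 [Kx /= fx]; split; first exact: KZ.
    by rewrite /= dotZr fx mulr0.
  - by apply: closedI => //; exact: closed_dot_eq.
split=> //; split.
- by move=> x [].
- by have [] := cc.
- exact: closed_coneW.
move=> a b Ka Kb [_ /= /eqP]; rewrite dotDr paddr_eq0 ?fnn//.
by move=> /andP[/eqP fa _]; split.
Qed.

(** By [exists_exposed], a functional that vanishes on the exposed vectors takes neither sign on K,
    so the exposed vectors span. *)
Lemma exposed_basis n (K : set 'rV[R]_n) :
  closed_cone K -> pointed K ->
  (forall f, (forall x, K x -> dot f x = 0) -> f = 0) ->
  exists k (B : 'M[R]_(k, n)), [/\ row_free B,
    forall i, K (row i B) /\ exposed K (row i B) &
    forall f, (forall i, dot f (row i B) = 0) -> f = 0].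
Proof.
move=> ccK ptK genK.
have [k [B [freeB BP Bspan]]] :=
  exists_spanning_rows [set x | K x /\ exposed K x].
exists k, B; split => // f fB; apply: genK => x Kx.
have fexp y : K y -> exposed K y -> dot f y = 0.
  move=> Ky yexp; rewrite (eq_dot_submx (A := B) (g := 0)) ?dot0l//.
    by move=> i; rewrite dot0l.
  exact: Bspan.
apply/eqP; rewrite eq_le; apply/andP; split; rewrite leNgt; apply/negP => fx.
  have [y [Ky yexp]] := exists_exposed ccK ptK Kx fx.
  by rewrite fexp ?ltxx.
have [|y [Ky yexp]] := @exists_exposed _ _ K (- f) x ccK ptK Kx.
  by rewrite dotNl oppr_gt0.
by rewrite dotNl fexp ?oppr0 ?ltxx.
Qed.

(* Equivalently, the sum of the rows of B with index in I is interior to K. *)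
Definition detects n (K : set 'rV[R]_n) k (B : 'M[R]_(k, n)) (I : {set 'I_k}) :=
  forall f, nonneg_on K f ->
    (forall i, i \in I -> dot f (row i B) = 0) -> f = 0.

(** By minimality of I, dropping i leaves some nonzero functional undetected; it must be positive on
    row i. Up to positive factors these functionals read off coordinates along the rows in I. *)
Lemma minimal_detecting_set n (K : set 'rV[R]_n) k (B : 'M[R]_(k, n)) :
  (forall i, K (row i B)) -> detects K B (setTfor 'I_k) ->
  exists2 I : {set 'I_k}, detects K B I &
    exists phi : 'I_k -> 'rV[R]_n, forall i, i \in I ->
      [/\ nonneg_on K (phi i), 0 < dot (phi i) (row i B) &
          forall j, j \in I -> j != i -> dot (phi i) (row j B) = 0].
Proof.
move=> KB BT.
have [I /minsetP[/asboolP dI Imin] _] :=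
  @minset_exists _ (fun I => `[< detects K B I >]) (setTfor 'I_k) (asboolT BT).
exists I => //.
suff /choice[phi phiP] : forall i, exists f, i \in I ->
    [/\ nonneg_on K f, 0 < dot f (row i B) &
        forall j, j \in I -> j != i -> dot f (row j B) = 0].
  by exists phi.
move=> i; case: (boolP (i \in I)) => iI; last by exists 0.
have : ~ detects K B (I :\ i).
  move=> dIi; have := Imin (I :\ i)%SET (asboolT dIi) (finset.subsetDl _ _).
  by move/finset.setP/(_ i); rewrite !inE eqxx iI.
move=> /existsNP[f /not_implyP[fnn /not_implyP[fI fn0]]].
exists f => _.
have fj j : j \in I -> j != i -> dot f (row j B) = 0.
  by move=> jI ji; apply: fI; rewrite !inE ji.
split => //; rewrite lt_def fnn// andbT; apply/negP => /eqP fi.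
apply: fn0; apply: dI => // j jI.
by have [->//|ji] := eqVneq j i; exact: fj.
Qed.

Lemma exists_sandwich n : has_sandwich n.
Proof.
elim/ltn_ind: n => n IH K ccK ptK nsK.
have [genK|/existsNP[f /not_implyP[fK /eqP fn0]]] :=
  pselect (forall f, (forall x, K x -> dot f x = 0) -> f = 0); last first.
  exact: sandwiched_hyperplane fK.
have [K0 KD KZ clK] := ccK.
have [k [B [freeB BP Bgen]]] := exposed_basis ccK ptK genK.
have KB i : K (row i B) by case: (BP i).
have [|I dI [phi phiP]] := minimal_detecting_set KB.
  by move=> f _ fB; apply: Bgen => i; apply: fB; rewrite inE.
(* Rows outside [I] become 0, so that [A] spans W while keeping the index type of [B]. *)
pose A := \matrix_i (if i \in I then row i B else 0).
have rowA i : row i A = if i \in I then row i B else 0 by rewrite rowK.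
have rowBA i : i \in I -> (row i B <= A)%MS.
  by move=> iI; have := row_sub i A; rewrite rowA iI.
have KA i : K (row i A) by rewrite rowA; case: ifP.
have Adet f : nonneg_on K f -> (forall i, dot f (row i A) = 0) -> f = 0.
  by move=> fnn fA; apply: dI => // i iI; have := fA i; rewrite rowA iI.
have coordA c i : i \in I ->
    dot (phi i) (c *m A) = c 0 i * dot (phi i) (row i B).
  move=> iI; have [_ _ pj] := phiP i iI.
  rewrite mulmx_sum_row dot_sumr (bigD1 i)//= rowA iI dotZr big1 ?addr0//.
  move=> j ji; rewrite rowA dotZr; case: ifP => jI; rewrite ?dot0r ?mulr0//.
  by rewrite pj ?mulr0.
have coord_ge0 c i : K (c *m A) -> i \in I -> 0 <= c 0 i.
  move=> Kc iI; have [pnn ppos _] := phiP i iI.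
  by rewrite -(pmulr_lge0 _ ppos) -coordA ?pnn.
(* Otherwise the [phi i] show that all points of K have nonnegative coordinates in the basis [B],
   and K is simplicial. *)
have [i1 i1I] : exists i, i \notin I.
  apply: contrapT => /forallNP allI; apply: nsK; exists k, B; split => // x.
  have BA : A = B.
    apply/row_matrixP => i; rewrite rowA; case: ifP => // /negbT /allI [].
  split=> [Kx|[c c0 ->]].
    have /submxP[c xE] : (x <= B)%MS.
      by apply: submx_dotP => h /Bgen ->; rewrite dot0l.
    exists c => // i; apply: coord_ge0; first by rewrite BA -xE.
    by apply: contrapT => /negP /allI.
  rewrite mulmx_sum_row; elim/big_ind: _ => // i _.
  by apply: KZ; rewrite ?c0.
have i1A : ~ (row i1 B <= A)%MS.
  move=> /submxP[c]; rewrite rowE.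
  (* The diagonal 0-1 matrix has a zero at [i1], so freeness of [B] excludes row [i1]. *)
  have -> : A = (\matrix_(i, j) ((i == j) && (i \in I))%:R) *m B.
    apply/row_matrixP => i; rewrite rowA row_mul.
    rewrite (_ : row i _ = (i \in I)%:R *: delta_mx 0 i); last first.
      apply/rowP => j; rewrite !mxE eqxx/= eq_sym.
      by case: (j == i); rewrite ?mulr1 ?mulr0.
    by rewrite -scalemxAl -rowE; case: ifP; rewrite ?scale1r ?scale0r.
  rewrite mulmxA => /(row_free_injr freeB) /rowP/(_ i1).
  rewrite !mxE !eqxx big1 => [/eqP|j _]; first by rewrite oner_eq0.
  rewrite mxE; have [->|] := eqVneq j i1; last by rewrite mulr0.
  by rewrite (negbTE i1I) mulr0.
have [h hA hi1] : exists2 h, forall i, dot h (row i A) = 0 &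
    dot h (row i1 B) != 0.
  apply: contrapT => no; apply: i1A; apply: submx_dotP => h hA.
  by apply/eqP; apply: contrapT => /negP hi; apply: no; exists h.
(* If [I] were empty, every functional nonnegative on K would be 0, against [exists_pos_on]. *)
have [i0 i0I] : exists i, i \in I.
  apply: contrapT => /forallNP noI.
  have [u0 u0pos] := exists_pos_on ccK ptK.
  have u00 : u0 = 0 by apply: dI (pos_onW u0pos) _ => i /noI.
  have := u0pos _ (KB i1); rewrite u00 dot0l ltxx => /(_ _)/negP[]//.
  by apply: contraNneq hi1 => ->; rewrite dot0r.
have [pnn ppos pj] := phiP i0 i0I.
have [_ [psi psinn [psi0 psiexp]]] := BP i0.
(* On K, [psi] vanishes only on multiples of row [i0], and [phi i0] is positive at that row. *)
have upos : pos_on K (psi + phi i0).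
  move=> x Kx xn0; rewrite lt_def dotDl addr_ge0 ?andbT ?psinn ?pnn//.
  apply: contraNneq xn0 => /eqP; rewrite paddr_eq0 ?psinn ?pnn//.
  move=> /andP[/eqP /(psiexp _ Kx)[a ->]].
  by rewrite dotZr mulf_eq0 (gt_eqF ppos) orbF => /eqP ->; rewrite scale0r.
have [f3 [f4 [x3 [x4 [[f3nn f4nn f34 Kx3 Kx4] [x3n0 f3x3 f4x4]]]]]] :=
  antipodal_support ccK upos KA Adet hA (KB i1) hi1.
set u := psi + phi i0 in upos f34.
move=> /submxP[c x34] [a /andP[a0 a1] f3A].
have c_ge0 i : i \in I -> 0 <= c 0 i.
  by apply: coord_ge0; rewrite -x34; exact: KD.
have x34E : x3 + x4 = \sum_(i in I) c 0 i *: row i B.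
  rewrite x34 mulmx_sum_row [RHS]big_mkcond; apply: eq_bigr => i _.
  by rewrite rowA; case: ifP; rewrite ?scaler0.
(* On W, [f3] is [a] times [u], but it vanishes at [x3], where [u] is positive. *)
have x3A : ~ (x3 <= A)%MS.
  move=> /f3A; rewrite f3x3 => /esym/eqP.
  by rewrite mulf_eq0 !gt_eqF// upos.
rewrite (bigD1 i0)//= in x34E; set x2 := (X in _ = _ + X) in x34E.
have Kx2 : K x2.
  rewrite /x2; elim/big_ind: _ => // i /andP[iI _].
  by apply: KZ; rewrite ?c_ge0.
have px2 : dot (phi i0) x2 = 0.
  by rewrite dot_sumr big1// => i /andP[iI ii0]; rewrite dotZr pj ?mulr0.
(* If the coefficient at [i0] is 0, then [x3] and [x4] lie in the face phi i0 = 0. Were this face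
   simplicial, [simplicial_exposed_sum] would put [x3] in W. *)
have := c_ge0 _ i0I; rewrite le_eqVlt => /orP[/eqP ci0|ci0].
  have [ccH faceH] := face_hyperplane ccK pnn; set H := _ `&` _ in ccH faceH.
  have x34E' : x3 + x4 = x2 by rewrite x34E -ci0 scale0r add0r.
  have := px2; rewrite -x34E' dotDr => /eqP.
  rewrite paddr_eq0 ?pnn// => /andP[/eqP px3 /eqP px4].
  have HK : H `<=` K by move=> x [].
  apply: (sandwiched_face faceH).
  apply: (sandwiched_hyperplane (f := phi i0)) => //.
  - by move=> x /HK Kx /HK; exact: ptK.
  - move=> sH; apply: x3A.
    apply: (simplicial_exposed_sum (P := fun i => (i \in I) && (i != i0))
      (b := fun i => row i B) sH _ _ _ _ _ x34E').
    + by [].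
    + by [].
    + by move=> i /andP[iI ii0]; split => //=; rewrite pj.
    + by move=> i _; apply: (exposed_face HK); case: (BP i).
    + by move=> i /andP[iI _]; exact: rowBA.
  - by apply: contraTneq ppos => ->; rewrite dot0l ltxx.
  - by move=> x [].
exists K; first by apply: face_refl => //; exact: closed_coneW.
exists (c 0 i0 *: row i0 B), x2, x3, x4, (row_dual psi), (row_dual (phi i0)),
  (row_dual f3), (row_dual f4); split.
- by split => //; apply: KZ => //; exact: ltW.
- by split=> x Kx; rewrite row_dualE;
    [exact: psinn | exact: pnn | exact: f3nn | exact: f4nn].
- rewrite scaler_eq0 negb_or gt_eqF//=.
  by apply: contraTneq ppos => ->; rewrite dot0r ltxx.
- by [].
- by rewrite -!row_dualD f34.
- by rewrite !row_dualE dotZr psi0 mulr0.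
(* The corner condition: a zero of [psi] in K is a multiple of row [i0], hence in W, where [f3] and
   [f4] are the positive multiples [a] and 1 - a of [u]. *)
move=> x Kx; rewrite !row_dualE => /(psiexp _ Kx)[d xE] f34x.
have xA : (x <= A)%MS by rewrite xE scalemx_sub// rowBA.
have f4E : dot f4 x = (1 - a) * dot u x.
  by rewrite mulrBl mul1r -(f3A _ xA) -f34 dotDl addrC addKr.
apply/eqP; apply: contraPT f34x => xn0; have ux := upos _ Kx xn0.
rewrite (f3A _ xA) f4E.
by case => /eqP; rewrite mulf_eq0 !gt_eqF ?subr_gt0.
Qed.

End Existence.

(** * Transfer to abstract vector spaces *)

Section Coordinates.
Context {R : realType} {V : vectType R}.
Implicit Types C : set V.

Let b := vbasis {:V}.
Let vec : 'Hom('rV[R]_(\dim {:V}), V) := linfun (vecof b).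

Lemma basis_b : basis_of {:V} b. Proof. exact: vbasisP. Qed.

Lemma vecE v : vec v = vecof b v. Proof. by rewrite lfunE. Qed.

Lemma vec_inj : lker vec == 0%VS.
Proof.
apply/lker0P => v w; rewrite !vecE.
exact: (can_inj (vecofK basis_b)).
Qed.

Lemma vec_surj x : exists v, x = vec v.
Proof. by exists (rVof b x); rewrite vecE rVofK ?basis_b. Qed.

Lemma rows_of_closed C : closed_vect C -> closed (vec @^-1` C).
Proof.
rewrite /closed_vect; set A := (X in closed X); set B := (X in _ -> closed X).
suff -> : B = A by [].
by apply/funext => v; rewrite /A /B /= vecE.
Qed.

Lemma proper_cone0 C : is_proper C -> C 0.
Proof.
case=> _ _ C0 _; have : [set (0 : V)] 0 by [].
by rewrite -C0 => -[].
Qed.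

Lemma proper_closed_cone C : is_proper C -> closed_cone (vec @^-1` C).
Proof.
move=> /[dup] /proper_cone0 C0 [coneC clC _ _]; split; rewrite /= ?linear0//.
- by move=> v w Cv Cw; rewrite linearD; exact: is_coneD.
- by move=> a v a0 Cv; rewrite linearZ; exact: is_coneZ.
- exact: rows_of_closed.
Qed.

Lemma proper_pointed C : is_proper C -> pointed (vec @^-1` C).
Proof.
move=> [_ _ C0 _] v /= Cv; rewrite linearN => CNv.
have : (C `&` [set - x | x in C]) (vec v).
  by split => //; exists (- vec v); rewrite ?opprK.
rewrite C0 /= -(linear0 vec); exact: (lker0P vec_inj).
Qed.

Let codual (f : 'rV[R]_(\dim {:V})) : dual V := (row_dual f \o vec^-1)%VF.

Lemma codualE f v : codual f (vec v) = dot f v.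
Proof. by rewrite comp_lfunE lker0_lfunK ?vec_inj// row_dualE. Qed.

Lemma proper_separation C x : is_proper C -> ~ C x ->
  exists2 f : dual V, dual_cone C f & (f x : R) < 0.
Proof.
move=> pC; have [v ->] := vec_surj x => Cv.
have [f fnn fv] := cone_separation (proper_closed_cone pC) Cv.
exists (codual f); last by rewrite codualE.
by move=> y; have [w ->] := vec_surj y => Cw; rewrite codualE; exact: fnn.
Qed.

Lemma proper_pos_functional C : is_proper C ->
  exists f : dual V, forall x, C x -> x != 0 -> 0 < (f x : R).
Proof.
move=> pC.
have [f fpos] := exists_pos_on (proper_closed_cone pC) (proper_pointed pC).
exists (codual f) => x; have [v ->] := vec_surj x => Cv v0.
rewrite codualE; apply: fpos => //; apply: contraNneq v0 => ->.
by rewrite linear0.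
Qed.

Lemma cone_genP (a : seq V) k z : size a = k ->
  cone_gen a z <-> exists2 c : 'I_k -> R, forall i, 0 <= c i &
    z = \sum_i c i *: a`_i.
Proof.
by move=> <-; split=> [[c [c0 zE]]|[c c0 zE]]; exists c.
Qed.

(** The condition C - C = V makes the free generators span, so they form a basis. *)
Lemma classical_of_simplicial C :
  is_proper C -> simplicial (vec @^-1` C) -> is_classical C.
Proof.
move=> [_ _ _ genC] [k [A [freeA AC]]].
pose a := [tuple vec (row i A) | i < k].
have aE (c : 'I_k -> R) : \sum_i c i *: a`_i = vec ((\row_i c i) *m A).
  rewrite mulmx_sum_row linear_sum; apply: eq_bigr => i _.
  by rewrite linearZ mxE -tnth_nth tnth_mktuple.
have Ak : (\dim {:V} <= k)%N.
  have fullA : row_full A.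
    rewrite -sub1mx; apply/row_subP => i; set v := row i _.
    have : [set x - y | x in C & y in C] (vec v) by rewrite genC.
    move=> [x Cx [y Cy]]; have [v1 v1E] := vec_surj x.
    have [v2 v2E] := vec_surj y; rewrite v1E v2E -linearB in Cx Cy *.
    move=> /(lker0P vec_inj) <-.
    have [/AC[c1 _ ->] /AC[c2 _ ->]] := (Cx, Cy).
    by rewrite -mulmxBl submxMl.
  by rewrite -(eqP fullA) rank_leq_row.
exists a; split.
  rewrite basisEfree size_tuple Ak subvf !andbT.
  apply/(@freeP _ _ k a) => c.
  rewrite aE -(linear0 vec) => /(lker0P vec_inj) cA i.
  have : (\row_i c i) *m A = 0 *m A by rewrite mul0mx.
  by move=> /(row_free_injr freeA)/rowP/(_ i); rewrite !mxE.
apply/seteqP; split=> z.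
  have [v ->] := vec_surj z => /AC[c c0 ->].
  apply/(cone_genP _ (size_tuple a)); exists (c 0) => //.
  by rewrite aE; congr (vec (_ *m _)); apply/rowP => i; rewrite mxE.
move=> /(cone_genP _ (size_tuple a))[c c0 ->]; rewrite aE.
by apply/AC; exists (\row_i c i) => // i; rewrite mxE.
Qed.

Lemma proper_sandwiched C : is_proper C -> ~ is_classical C -> sandwiched C.
Proof.
move=> pC nC; apply: (sandwiched_preimage vec_inj).
  by move=> y _; exact: vec_surj.
apply: exists_sandwich.
- exact: proper_closed_cone.
- exact: proper_pointed.
- by move=> /(classical_of_simplicial pC).
Qed.

(** Reduces identities between vectors to scalar ones, within reach of [ring]. *)
Lemma dual_ext (x y : V) : (forall f : dual V, f x = f y) -> x = y.
Proof.
move=> xy; rewrite (coord_vbasis (memvf x)) (coord_vbasis (memvf y)).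
apply: eq_bigr => i _; congr (_ *: _).
by have := xy (linfun (coord (vbasis {:V}) i : V -> R^o)); rewrite !lfunE.
Qed.

End Coordinates.

(** * The Clauser-Horne inequality on two squares *)

Section CHSH.
Variable R : realType.

(* In the equality case the zeros are those where a or b is a vertex of its
   square [a_i >= 0]; positivity of a2 and b2 leaves two of the four
   vertices for each. *)
Lemma chsh_ge0_eq0 (a1 a2 a3 a4 b1 b2 b3 b4 : R) :
    0 <= a1 -> 0 <= a2 -> 0 <= a3 -> 0 <= a4 -> a1 + a2 = a3 + a4 ->
    0 <= b1 -> 0 <= b2 -> 0 <= b3 -> 0 <= b4 -> b1 + b2 = b3 + b4 ->
    0 <= a4 * b4 + a2 * b3 + a3 * b2 - a2 * b2 /\
    (a4 * b4 + a2 * b3 + a3 * b2 - a2 * b2 = 0 -> 0 < a2 -> 0 < b2 ->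
     a1 = 0 /\ (a3 = 0 \/ a4 = 0) \/ b1 = 0 /\ (b3 = 0 \/ b4 = 0)).
Proof.
have prod0 (s t : R) : 0 <= s -> 0 <= t -> s * t <= 0 -> s = 0 \/ t = 0.
  move=> s0 t0 st.
  have /eqP : s * t = 0 by apply/eqP; rewrite eq_le st mulr_ge0.
  by rewrite mulf_eq0 => /orP[/eqP|/eqP]; [left | right].
(* For c2 <= c3 the form is a sum of three nonnegative terms. This settles a2 <= a3 and, by
   symmetry, b2 <= b3. *)
have caseA (c1 c2 c3 c4 d1 d2 d3 d4 : R) :
    0 <= c1 -> 0 <= c2 -> 0 <= c3 -> 0 <= c4 -> c1 + c2 = c3 + c4 ->
    0 <= d1 -> 0 <= d2 -> 0 <= d3 -> 0 <= d4 -> d1 + d2 = d3 + d4 ->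
    c2 <= c3 ->
    0 <= c4 * d4 + c2 * d3 + c3 * d2 - c2 * d2 /\
    (c4 * d4 + c2 * d3 + c3 * d2 - c2 * d2 = 0 -> 0 < c2 -> 0 < d2 ->
     c1 = 0 /\ (c3 = 0 \/ c4 = 0)).
  move=> c1p c2p c3p c4p cE d1p d2p d3p d4p dE; rewrite -subr_ge0 => c23.
  have -> : c4 * d4 + c2 * d3 + c3 * d2 - c2 * d2 =
    c4 * d4 + c2 * d3 + (c3 - c2) * d2 by ring.
  have := mulr_ge0 c4p d4p; have := mulr_ge0 c2p d3p; have := mulr_ge0 c23 d2p.
  move=> h1 h2 h3; split; first by rewrite !addr_ge0.
  move=> h0 c2n0 d2n0.
  have [|c40|d40] := prod0 _ _ c4p d4p; first lra.
    have [|e|e] := prod0 _ _ c23 d2p; [lra | | exfalso; lra].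
    by split; [lra | right].
  by have [|e|e] := prod0 _ _ c2p d3p; [lra | exfalso; lra | exfalso; lra].
move=> a1p a2p a3p a4p aE b1p b2p b3p b4p bE.
have [a23|a23] := leP a2 a3.
  have [h1 h2] := caseA _ _ _ _ _ _ _ _
    a1p a2p a3p a4p aE b1p b2p b3p b4p bE a23.
  by split => // ? ? ?; left; exact: h2.
have -> : a4 * b4 + a2 * b3 + a3 * b2 - a2 * b2 =
  b4 * a4 + b2 * a3 + b3 * a2 - b2 * a2 by ring.
have [b23|b23] := leP b2 b3.
  have [h1 h2] := caseA _ _ _ _ _ _ _ _
    b1p b2p b3p b4p bE a1p a2p a3p a4p aE b23.
  by split => // ? ? ?; right; exact: h2.
have x0 : 0 < a2 - a3 by rewrite subr_gt0.
have y0 : 0 < b2 - b3 by rewrite subr_gt0.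
(* In the remaining case all four products are nonnegative, and their vanishing forces a1 = b1 = 0
   and a3 b3 = 0. *)
have -> : b4 * a4 + b2 * a3 + b3 * a2 - b2 * a2 =
    a1 * b1 + a1 * (b2 - b3) + b1 * (a2 - a3) + a3 * b3.
  have -> : a4 = a1 + a2 - a3 by lra.
  have -> : b4 = b1 + b2 - b3 by lra.
  by ring.
have := mulr_ge0 a1p b1p; have := mulr_ge0 a1p (ltW y0).
have := mulr_ge0 b1p (ltW x0); have := mulr_ge0 a3p b3p => h1 h2 h3 h4.
split; first by rewrite !addr_ge0.
move=> h0 _ _.
have [|e1|e1] := prod0 _ _ a1p (ltW y0); [lra | | exfalso; lra].
have [|e2|e2] := prod0 _ _ b1p (ltW x0); [lra | | exfalso; lra].
have [|e3|e3] := prod0 _ _ a3p b3p; first lra.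
  by left; split => //; left.
by right; split => //; left.
Qed.

(** This vector is [kite_tensor] evaluated at a functional f with ai = f xi, so its membership in
    the cone is what puts the tensor in the maximal product. *)
Lemma kite_combination (V : vectType R) (C : set V) (y1 y2 y3 y4 : V)
    (a1 a2 a3 a4 : R) :
  is_cone C -> C y1 -> C y2 -> C y3 -> C y4 -> y1 + y2 = y3 + y4 ->
  0 <= a1 -> 0 <= a2 -> 0 <= a3 -> 0 <= a4 -> a1 + a2 = a3 + a4 ->
  C (a1 *: (y3 - y2) + a3 *: y4 + a4 *: y2).
Proof.
move=> coneC C1 C2 C3 C4 yE a1p a2p a3p a4p aE.
(* The coefficient of [y2] below is then [a4] if the minimum is [a1], and [a2] if it is [a3]. *)
pose a := Num.min a1 a3.
have [aa1 aa3 aa0] : [/\ 0 <= a, a <= a1 & a <= a3].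
  by rewrite le_min a1p a3p ge_min lexx ge_min lexx orbT.
have aa4 : 0 <= a4 - a1 + a.
  by rewrite /a; case: (leP a1 a3) => _; lra.
have -> : a1 *: (y3 - y2) + a3 *: y4 + a4 *: y2 =
    a *: y1 + (a1 - a) *: y3 + (a3 - a) *: y4 + (a4 - a1 + a) *: y2.
  have -> : y1 = y3 + y4 - y2 by rewrite -yE addrK.
  apply: dual_ext => f; rewrite !(linearD, linearN, linearZ) /=.
  move: (f y2 : R) (f y3 : R) (f y4 : R) => t2 t3 t4.
  by rewrite /GRing.scale /=; ring.
by apply: is_coneD => //; [apply: is_coneD => //; [apply: is_coneD |] |];
  rewrite ?subr_ge0 //; apply: is_coneZ; rewrite ?subr_ge0.
Qed.

End CHSH.

(** * Values of the functionals at the vertices of a kite *)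

Section Kites.
Context {R : realType} {V : vectType R}.
Variables (F : set V) (x1 x2 x3 x4 : V) (f1 f2 f3 f4 : dual V).
Hypothesis kF : kite F x1 x2 x3 x4 f1 f2 f3 f4.

Lemma kite_swap : kite F x1 x2 x4 x3 f1 f2 f4 f3.
Proof.
case: kF => [[? ? ? ?] [? ? ? ?] ? xE fE [? ? ? ?] corner]; split => //.
- by rewrite xE addrC.
- by rewrite fE addrC.
by move=> a Fa fa /or_comm; exact: corner.
Qed.

Lemma kite_dual_sumE a : (f1 a + f2 a : R) = f3 a + f4 a.
Proof. by rewrite -!add_lfunE (kite_dual_sum kF). Qed.

Lemma kite_sumE (f : dual V) : (f x1 + f x2 : R) = f x3 + f x4.
Proof. by rewrite -!linearD (kite_sum kF). Qed.

(** Since f1 x1 = 0 and x1 is nonzero, the corner condition keeps f3 and f4 from vanishing at x1; f2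
    is their sum there. *)
Lemma kite_gt0 : [/\ 0 < (f2 x1 : R), 0 < (f3 x1 : R) & 0 < (f4 x1 : R)].
Proof.
have [F1 _ _ _] := kite_mem kF; have [_ f2p f3p f4p] := kite_dual kF.
have [f1x _ _ _] := kite_vanish kF; have x1n0 := kite_neq0 kF.
have corner h : h = f3 \/ h = f4 -> dual_cone F h -> 0 < (h x1 : R).
  move=> hE hp; rewrite lt_def hp// andbT; apply: contraNneq x1n0 => h0.
  by apply/eqP/(kite_corner kF) => //; case: hE => <-; [left | right].
have h3 := corner _ (or_introl erefl) f3p.
have h4 := corner _ (or_intror erefl) f4p.
split => //; have := kite_dual_sumE x1; rewrite f1x add0r => ->.
exact: addr_gt0.
Qed.

End Kites.

(** The left side is the Clauser-Horne form at [kite_tensor], with [f2x3] for f2 x3 and so on; the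
    literal zeros are values fi xi and gi yi. *)
Lemma kite_ch_value (R : realType)
    (f2x1 f2x3 f2x4 f3x1 f3x4 f4x1 f4x3 : R)
    (g2y1 g2y3 g2y4 g3y1 g3y2 g3y4 g4y1 g4y2 g4y3 : R) :
  f2x1 = f3x1 + f4x1 -> f2x1 = f2x3 + f2x4 ->
  g2y1 = g3y1 + g4y1 -> g2y1 = g2y3 + g2y4 ->
  g3y1 + g3y2 = g3y4 -> g4y1 + g4y2 = g4y3 ->
  (f4x1 * (g4y3 - g4y2) + f4x3 * 0 + 0 * g4y2)
  + (f2x1 * (0 - g3y2) + f2x3 * g3y4 + f2x4 * g3y2)
  + (f3x1 * (g2y3 - 0) + 0 * g2y4 + f3x4 * 0)
  - (f2x1 * (g2y3 - 0) + f2x3 * g2y4 + f2x4 * 0) =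
  (f3x1 - f2x4) * (g3y1 - g2y4).
Proof.
move=> fE1 fE2 gE1 gE2 <- <-.
have -> : f4x1 = f2x3 + f2x4 - f3x1 by lra.
rewrite addrK; have -> : g4y1 = g2y3 + g2y4 - g3y1 by lra.
by rewrite fE2; ring.
Qed.

(** If f2 g2 and the Clauser-Horne form both vanish at the tensor, then g2 y3 = 0, so g2 y4 > 0 and
    f2 x3 = 0. The two factors are then - f4 x1 and - g4 y1, both nonzero. *)
Lemma kite_ch_contradiction (R : realType)
    (f2x1 f2x3 f2x4 f3x1 f4x1 g2y1 g2y3 g2y4 g3y1 g4y1 : R) :
  f2x1 = f3x1 + f4x1 -> f2x1 = f2x3 + f2x4 ->
  g2y1 = g3y1 + g4y1 -> g2y1 = g2y3 + g2y4 ->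
  0 < f2x1 -> 0 < g2y1 -> 0 < f4x1 -> 0 < g4y1 ->
  0 <= f2x3 -> 0 <= f2x4 -> 0 <= g2y3 -> 0 <= g2y4 ->
  f2x1 * (g2y3 - 0) + f2x3 * g2y4 + f2x4 * 0 = 0 ->
  (f3x1 - f2x4) * (g3y1 - g2y4) = 0 -> False.
Proof.
move=> fE1 fE2 gE1 gE2 f2p g2p f4p g4p x3p x4p y3p y4p.
rewrite subr0 mulr0 addr0 => /eqP.
rewrite paddr_eq0 ?mulr_ge0 ?(ltW f2p)// !mulf_eq0 gt_eqF//=.
move=> /andP[/eqP y30] /orP[/eqP x30|/eqP y40]; last lra.
by move=> /eqP; rewrite mulf_eq0 => /orP[] /eqP; lra.
Qed.

(** * Non-nuclearity from two kites *)

Section NonNuclear.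
Context {R : realType} {V1 V2 : vectType R}.
Implicit Types (C : set V1) (D : set V2).

Lemma min_tensor_sum C D z : is_cone C -> min_tensor C D z ->
  exists n (a : 'I_n -> V1) (b : 'I_n -> V2),
    [/\ forall i, C (a i), forall i, D (b i) & z = \sum_i tens (a i) (b i)].
Proof.
move=> coneC [n [w [t [w0 _ tCD ->]]]].
have /choice[p pP] : forall i, exists p, [/\ C p.1, D p.2 & tens p.1 p.2 = t i].
  by move=> i; have [a Ca [b Db ab]] := tCD i; exists (a, b).
exists n, (fun i => w i *: (p i).1), (fun i => (p i).2); split => [i|i|].
- by have [Ca _ _] := pP i; exact: is_coneZ.
- by have [] := pP i.
apply: eq_bigr => i _; have [_ _ <-] := pP i; apply/lfunP => f.
by rewrite scale_lfunE !tensE [f (_ *: _)]linearZ scalerA.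
Qed.

Lemma face_sum (V : vectType R) (C F : set V) (I : finType) (a : I -> V) :
  is_cone C -> C 0 -> face C F -> (forall i, C (a i)) -> F (\sum_i a i) ->
  forall i, F (a i).
Proof.
move=> coneC C0 [_ _ _ faceF] Ca Fa i; apply: (faceF _ (\sum_(j | j != i) a j)).
- exact: Ca.
- by elim/big_ind: _ => // x y; exact: is_coneD.
by rewrite (bigD1 i) in Fa.
Qed.

Lemma face_scale (V : vectType R) (C F : set V) (s : R) (x : V) :
  face C F -> 0 < s -> F (s *: x) -> F x.
Proof.
move=> [_ _ coneF _] s0 Fx; rewrite -[x](scalerK (lt0r_neq0 s0)).
by apply: is_coneZ => //; rewrite invr_ge0 ltW.
Qed.

Definition kite_tensor (x1 x3 x4 : V1) (y2 y3 y4 : V2) : tensor V1 V2 :=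
  tens x1 (y3 - y2) + tens x3 y4 + tens x4 y2.

Lemma kite_tensorE x1 x3 x4 y2 y3 y4 (f : dual V1) :
  kite_tensor x1 x3 x4 y2 y3 y4 f =
  (f x1 : R) *: (y3 - y2) + (f x3 : R) *: y4 + (f x4 : R) *: y2.
Proof. by rewrite !add_lfunE !tensE. Qed.

Lemma kite_not_separable C D F G x1 x2 x3 x4 (f1 f2 f3 f4 : dual V1)
    y1 y2 y3 y4 (g1 g2 g3 g4 : dual V2) n (a : 'I_n -> V1) (b : 'I_n -> V2) :
  is_proper C -> is_proper D -> face C F -> face D G ->
  kite F x1 x2 x3 x4 f1 f2 f3 f4 -> kite G y1 y2 y3 y4 g1 g2 g3 g4 ->
  (f3 x1 - f2 x4 : R) * (g3 y1 - g2 y4 : R) <= 0 ->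
  (forall i, C (a i)) -> (forall i, D (b i)) ->
  kite_tensor x1 x3 x4 y2 y3 y4 <> \sum_i tens (a i) (b i).
Proof.
move=> pC pD faceF faceG kF kG tt Ca Db zE.
have [[FC F0 coneF _] [GD G0 coneG _]] := (faceF, faceG).
have [[coneC _ _ _] [coneD _ _ _]] := (pC, pD).
have [[Fx1 Fx2 Fx3 Fx4] [f1p f2p f3p f4p]] := (kite_mem kF, kite_dual kF).
have [[Gy1 Gy2 Gy3 Gy4] [g1p g2p g3p g4p]] := (kite_mem kG, kite_dual kG).
have zval (f : dual V1) (g : dual V2) :
    \sum_i (f (a i) : R) * (g (b i) : R) =
    (f x1 : R) * (g y3 - g y2 : R) + (f x3 : R) * (g y4 : R)
    + (f x4 : R) * (g y2 : R).
  transitivity (g (kite_tensor x1 x3 x4 y2 y3 y4 f) : R).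
    rewrite zE sum_lfunE linear_sum; apply: eq_bigr => i _.
    by rewrite tensE linearZ.
  by rewrite kite_tensorE !(linearD, linearN, linearZ).
have [p ppos] := proper_pos_functional pC.
have [q qpos] := proper_pos_functional pD.
have pge0 x : C x -> 0 <= (p x : R).
  by move=> Cx; have [->|/ppos/ltW] := eqVneq x 0; rewrite ?linear0//; apply.
have qge0 y : D y -> 0 <= (q y : R).
  by move=> Dy; have [->|/qpos/ltW] := eqVneq y 0; rewrite ?linear0//; apply.
(* Contracting the second factor with the positive functional [q] gives a point of F, so every
   summand lies in F as well. *)
have aF i : b i != 0 -> F (a i).
  move=> bi0; apply: (face_scale faceF (qpos _ (Db i) bi0)).
  apply: (@face_sum _ C F _ (fun i => (q (b i) : R) *: a i)) => //.
  - exact: (FC 0 F0).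
  - by move=> j; apply: is_coneZ => //; exact: qge0.
  rewrite (_ : \sum_i _ =
    (q y2 : R) *: (x4 - x1) + (q y4 : R) *: x3 + (q y3 : R) *: x1).
    (* Seen from the second factor, the first kite enters with 1 and 2, and 3 and 4, exchanged. *)
    apply: (kite_combination (y1 := x2) (a2 := q y1)) => //; try exact/qge0/GD.
      by rewrite addrC (kite_sum kF) addrC.
    by rewrite addrC (kite_sumE kG) addrC.
  apply: dual_ext => f; rewrite linear_sum /= !(linearD, linearN, linearZ) /=.
  transitivity (\sum_i (f (a i) : R) * (q (b i) : R)).
    by apply: eq_bigr => j _; rewrite linearZ /=; exact: mulrC.
  rewrite zval.
  move: (f x1 : R) (f x3 : R) (f x4 : R) (q y2 : R) (q y3 : R) (q y4 : R).
  by move=> *; rewrite /GRing.scale /=; ring.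
have bG i : a i != 0 -> G (b i).
  move=> ai0; apply: (face_scale faceG (ppos _ (Ca i) ai0)).
  apply: (@face_sum _ D G _ (fun i => (p (a i) : R) *: b i)) => //.
  - exact: (GD 0 G0).
  - by move=> j; apply: is_coneZ => //; exact: pge0.
  rewrite (_ : \sum_i _ =
    (p x1 : R) *: (y3 - y2) + (p x3 : R) *: y4 + (p x4 : R) *: y2).
    apply: (kite_combination (y1 := y1) (a2 := p x2)) => //; try exact/pge0/FC.
      exact: kite_sum kG.
    exact: kite_sumE kF p.
  rewrite -kite_tensorE zE sum_lfunE; apply: eq_bigr => j _.
  by rewrite tensE.
pose ch i : R :=
  (f4 (a i) : R) * (g4 (b i) : R) + (f2 (a i) : R) * (g3 (b i) : R) +
  (f3 (a i) : R) * (g2 (b i) : R) - (f2 (a i) : R) * (g2 (b i) : R).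
(* For nonzero factors, both lie in the faces; if f2 and g2 are positive there, the equality case
   leaves only vertices that the faces avoid. *)
have chP i : 0 <= ch i /\ (ch i = 0 -> (f2 (a i) : R) * (g2 (b i) : R) = 0).
  have [ai0|/[dup] ai0 /bG Gb] := eqVneq (a i) 0.
    by rewrite /ch ai0 !linear0 !mul0r subr0 !addr0.
  have [bi0|/[dup] bi0 /aF Fa] := eqVneq (b i) 0.
    by rewrite /ch bi0 !linear0 !mulr0 subr0 !addr0.
  have [ch0 chE] := chsh_ge0_eq0 (f1p _ Fa) (f2p _ Fa) (f3p _ Fa) (f4p _ Fa)
    (kite_dual_sumE kF (a i)) (g1p _ Gb) (g2p _ Gb) (g3p _ Gb) (g4p _ Gb)
    (kite_dual_sumE kG (b i)).
  split=> // /chE {}chE.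
  apply/eqP; rewrite mulf_eq0; apply/negPn; rewrite negb_or; apply/negP.
  move=> /andP[f2a g2b].
  case: chE.
  - by rewrite lt_def f2a f2p.
  - by rewrite lt_def g2b g2p.
  - by move=> [fa fa34]; move: ai0; rewrite (kite_corner kF Fa fa fa34) eqxx.
  - by move=> [gb gb34]; move: bi0; rewrite (kite_corner kG Gb gb gb34) eqxx.
have [f1x f2x f3x f4x] := kite_vanish kF.
have [g1y g2y g3y g4y] := kite_vanish kG.
have sum_ch : \sum_i ch i = (f3 x1 - f2 x4 : R) * (g3 y1 - g2 y4 : R).
  rewrite sumrB !big_split /= !zval.
  rewrite f3x f4x g2y g3y g4y.
  apply: (@kite_ch_value R _ _ _ _ _ _ _ (g2 y1) _ _ _ _ _ (g4 y1)).
  - by have := kite_dual_sumE kF x1; rewrite f1x add0r.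
  - by have := kite_sumE kF f2; rewrite f2x addr0.
  - by have := kite_dual_sumE kG y1; rewrite g1y add0r.
  - by have := kite_sumE kG g2; rewrite g2y addr0.
  - by have := kite_sumE kG g3; rewrite g3y add0r.
  - by have := kite_sumE kG g4; rewrite g4y addr0.
have [f2x1 f3x1 f4x1] := kite_gt0 kF; have [g2y1 g3y1 g4y1] := kite_gt0 kG.
have sum0 : \sum_i ch i = 0.
  apply/eqP; rewrite eq_le sumr_ge0 ?andbT ?sum_ch// => i _.
  by have [] := chP i.
have fg0 : \sum_i (f2 (a i) : R) * (g2 (b i) : R) = 0.
  apply: big1 => i _; apply: (chP i).2; move/eqP: sum0.
  rewrite psumr_eq0 => [/allP/(_ i (mem_index_enum i))/eqP//|j _].
  by have [] := chP j.
move: fg0 sum0; rewrite zval sum_ch g2y.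
apply: (@kite_ch_contradiction R _ _ _ _ (f4 x1) (g2 y1) _ _ _ (g4 y1)) => //.
- by have := kite_dual_sumE kF x1; rewrite f1x add0r.
- by have := kite_sumE kF f2; rewrite f2x addr0.
- by have := kite_dual_sumE kG y1; rewrite g1y add0r.
- by have := kite_sumE kG g2; rewrite g2y addr0.
- exact: f2p.
- exact: f2p.
- exact: g2p.
- exact: g2p.
Qed.

Lemma sandwiched_not_nuclear C D : is_proper C -> is_proper D ->
  sandwiched C -> sandwiched D -> ~ nuclear C D.
Proof.
move=> pC pD [F faceF [x1 [x2 [x3 [x4 [f1 [f2 [f3 [f4 kF]]]]]]]]].
move=> [G faceG kites] nCD.
have {kites} [y1 [y2 [y3 [y4 [g1 [g2 [g3 [g4 [kG tt]]]]]]]]] :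
    exists y1 y2 y3 y4 g1 g2 g3 g4, kite G y1 y2 y3 y4 g1 g2 g3 g4 /\
      (f3 x1 - f2 x4 : R) * (g3 y1 - g2 y4 : R) <= 0.
  move: kites => [y1 [y2 [y3 [y4 [g1 [g2 [g3 [g4 kG]]]]]]]].
  have [tt|tt] := leP ((f3 x1 - f2 x4 : R) * (g3 y1 - g2 y4 : R)) 0.
    by exists y1, y2, y3, y4, g1, g2, g3, g4.
  exists y1, y2, y4, y3, g1, g2, g4, g3; split; first exact: kite_swap.
  suff -> : (g4 y1 - g2 y3 : R) = - (g3 y1 - g2 y4 : R).
    by rewrite mulrN oppr_le0 ltW.
  have arith (s t v w r : R) : s = t + v -> s = w + r -> v - w = - (t - r).
    by lra.
  apply: (arith (g2 y1)).
    have := kite_dual_sumE kG y1; have [-> _ _ _] := kite_vanish kG.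
    by rewrite add0r.
  by have := kite_sumE kG g2; have [_ -> _ _] := kite_vanish kG; rewrite addr0.
have [[FC _ _ _] [GD _ coneG _]] := (faceF, faceG).
have [[Fx1 Fx2 Fx3 Fx4] _] := (kite_mem kF, kite_dual kF).
have [[Gy1 Gy2 Gy3 Gy4] _] := (kite_mem kG, kite_dual kG).
have : min_tensor C D (kite_tensor x1 x3 x4 y2 y3 y4).
  rewrite nCD => f g fC gD; rewrite tens_funE kite_tensorE; apply/gD/GD.
  apply: (kite_combination (y1 := y1) (a2 := f x2)) => //; try exact/fC/FC.
    exact: kite_sum kG.
  exact: kite_sumE kF f.
have [coneC _ _ _] := pC.
move=> /(min_tensor_sum coneC)[n [a [b [Ca Db]]]].
exact: (kite_not_separable pC pD faceF faceG kF kG).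
Qed.

(** * Nuclearity when one cone is classical *)

Lemma min_sub_max C D : min_tensor C D `<=` max_tensor C D.
Proof.
move=> _ [n [w [t [w0 _ tCD ->]]]] f g fC gD.
rewrite linear_sum /= sumr_ge0// => i _; have [a Ca [b Db <-]] := tCD i.
rewrite [tens_fun f g _]linearZ /= tens_fun_tens; apply: mulr_ge0 => //.
by rewrite mulr_ge0 ?fC ?gD.
Qed.

Lemma sum_min_tensor C D n (a : 'I_n -> V1) (b : 'I_n -> V2) :
  is_cone C -> C 0 -> D 0 -> (forall i, C (a i)) -> (forall i, D (b i)) ->
  min_tensor C D (\sum_i tens (a i) (b i)).
Proof.
move=> coneC C0 D0 Ca Db.
have N0 : (n.+1%:R : R) != 0 by rewrite pnatr_eq0.
(* Equal weights, compensated in the first factor. The additional zero tensor makes the weights sum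
   to 1 even for n = 0. *)
exists n.+1, (fun=> n.+1%:R^-1), (fun i => if unlift ord0 i is Some j then
  tens (n.+1%:R *: a j) (b j) else tens 0 0); split.
- by move=> i; rewrite invr_ge0.
- by rewrite sumr_const card_ord -[LHS]mulr_natr mulVf.
- move=> i; case: unliftP => [j _|_]; last by exists 0 => //; exists 0.
  by exists (n.+1%:R *: a j); [exact: is_coneZ | exists (b j)].
rewrite big_ord_recl unlift_none.
rewrite (_ : tens 0 0 = 0 :> tensor V1 V2); last first.
  by apply/lfunP => f; rewrite tensE scaler0 zero_lfunE.
rewrite scaler0 add0r; apply: eq_bigr => i _; rewrite liftK.
apply/lfunP => f; rewrite scale_lfunE !tensE [f (_ *: _)]linearZ !scalerA.
by rewrite mulKf.
Qed.

Lemma classical_dual_basis (V : vectType R) (C : set V) : is_classical C ->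
  exists n (s : 'I_n -> V) (f : 'I_n -> dual V),
    [/\ forall i, C (s i), forall i, dual_cone C (f i) &
        forall x, x = \sum_i (f i x : R) *: s i].
Proof.
move=> [s [bs ->]]; pose t := in_tuple s; have bt : basis_of {:V} t by [].
exists (size s), (fun i => s`_i), (fun i => linfun (coord t i : V -> R^o)).
split=> [i|i x|x].
- exists (fun j => (j == i)%:R); split; first by move=> j; rewrite ler0n.
  rewrite (bigD1 i)//= eqxx scale1r big1 ?addr0// => j /negbTE ->.
  by rewrite scale0r.
- move=> [c [c0 ->]]; rewrite lfunE /= (coord_sum_free (X := t) c)//.
  exact: basis_free bt.
rewrite {1}(coord_basis bt (memvf x)).
by apply: eq_bigr => i _; rewrite lfunE.
Qed.

(** The contraction is a functional on the dual of V1; finite dimension lets a vector of V1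
    represent it. *)
Lemma tensor_contract_right (g : dual V2) (z : tensor V1 V2) :
  exists a : V1, forall f : dual V1, f a = g (z f).
Proof.
exists (\sum_i (g (z (linfun (coord (vbasis {:V1}) i : V1 -> R^o))) : R) *:
  (vbasis {:V1})`_i) => f.
rewrite {2}(tens_decomp z) sum_lfunE !linear_sum; apply: eq_bigr => i _ /=.
by rewrite tensE [LHS]linearZ [RHS]linearZ; exact: mulrC.
Qed.

(** Expand z along the basis of the classical cone. A coefficient outside the other cone would be
    separated from it by a functional, contradicting membership in the maximal product. *)
Lemma classical_nuclear C D : is_proper C -> is_proper D ->
  is_classical C \/ is_classical D -> nuclear C D.
Proof.
move=> pC pD clCD; apply/seteqP; split; first exact: min_sub_max.
move=> z zmax; have [coneC _ _ _] := pC.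
have [C0 D0] := (proper_cone0 pC, proper_cone0 pD).
case: clCD => /classical_dual_basis[n [s [f [sC fC sE]]]].
  have -> : z = \sum_i tens (s i) (z (f i)).
    apply/lfunP => g; rewrite sum_lfunE.
    have {1}-> : g = \sum_i (g (s i) : R) *: f i.
      apply/lfunP => x; rewrite sum_lfunE {1}(sE x) linear_sum.
      by apply: eq_bigr => i _; rewrite scale_lfunE [LHS]linearZ; exact: mulrC.
    by rewrite linear_sum; apply: eq_bigr => i _; rewrite tensE linearZ.
  apply: sum_min_tensor => // i.
  apply: contrapT => /(proper_separation pD)[g gD].
  by rewrite ltNge => /negP; apply; rewrite -tens_funE; exact: zmax.
have /choice[a aE] := fun i => tensor_contract_right (f i) z.
have -> : z = \sum_i tens (a i) (s i).
  apply/lfunP => g; rewrite sum_lfunE {1}(sE (z g)).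
  by apply: eq_bigr => i _; rewrite tensE aE.
apply: sum_min_tensor => // i.
apply: contrapT => /(proper_separation pC)[g gC].
by rewrite ltNge => /negP; apply; rewrite aE -tens_funE; exact: zmax.
Qed.

End NonNuclear.

Theorem theorem1 (R : realType) (V1 V2 : vectType R)
    (C1 : set V1) (C2 : set V2)
    (hC1 : is_proper C1) (hC2 : is_proper C2) :
  nuclear C1 C2 <-> is_classical C1 \/ is_classical C2.
Proof.
split=> [nuc|]; last exact: classical_nuclear.
apply: contrapT => /not_orP[nC1 nC2].
by apply: (sandwiched_not_nuclear hC1 hC2) nuc; exact: proper_sandwiched.
Qed.
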